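(* Let $X$ be a real Banach space of dimension greater than one and let $T:X\rightrightarrows X^*$ be a (non-empty) monotone operator whose domain $D(T)$ is nearly-convex and not a singleton. Consider the following assumptions: (H) for every $x\in D(T)$ the set $T(x)$ is weak-star closed and convex, and for every $x\in\overline{D(T)}$ and every $v\in\operatorname{ri}T_{\overline{D(T)}}(x)$, $$\inf_{h>0}\ \inf_{x^*\in T(x+hv)}\langle v,x^*\rangle\ \le\ \sup_{x^*\in T(x)}\langle v,x^*\rangle;$$ (D) $T$ has convex values and is demiclosed; (R) $T$ is representable. Then $T$ is maximal monotone if and only if $T=T+N_{D(T)}$ and at least one of (H), (D), (R) holds; equivalently, $T$ is maximal monotone if and only if $T=T+N_{D(T)}$ and all of (H), (D), (R) hold.
   Context: $X^*$ is the topological dual of $X$, $\langle x,x^*\rangle:=x^*(x)$, and closures in $X$ are in norm. A multifunction $T:X\rightrightarrows X^*$ is identified with its graph $\{(x,x^* )\mid x^*\in T(x)\}$; its domain is $D(T)=\{x\mid T(x)\neq\emptyset\}$. $T$ is monotone if $\langle x_1-x_2,x_1^*-x_2^*\rangle\ge0$ for all $(x_1,x_1^* ),(x_2,x_2^* )\in T$; it is maximal monotone if it is monotone and its graph is not properly contained in the graph of another monotone operator $X\rightrightarrows X^*$. Sums are pointwise. For $C\subset X$, $N_C(x)=\{x^*\in X^*\mid\langle y-x,x^*\rangle\le0\ \forall y\in C\}$ if $x\in C$, $N_C(x)=\emptyset$ otherwise. For $S\subset X$, $\operatorname{ri}S$ is the interior of $S$ relative to the norm closure of its affine hull. $S$ is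 nearly-convex if there is a convex set $C$ with $\operatorname{ri}C\neq\emptyset$ and $C\subset S\subset\overline C$. For a convex set $C$ and $x\in\overline C$, $T_C(x)$ denotes the tangent cone to $C$ at $x$, i.e. the closure of $\bigcup_{h>0}h(C-x)$ (the notation $T_C(x)$ for the tangent cone is unrelated to the operator $T$). $T$ is demiclosed if whenever $(x_i,x_i^* )_i$ is a net in the graph of $T$ with $x_i\to x_0$ in norm, $x_i^*\to x_0^*$ weakly-star and $(x_i^* )_i$ norm bounded, one has $(x_0,x_0^* )\in T$. $T$ is representable if there is a proper convex function $f:X\times X^*\to\mathbb{R}\cup\{+\infty\}$, lower semicontinuous for the norm$\times$weak-star topology, with $f(x,x^* )\ge\langle x,x^*\rangle$ everywhere and $T=\{(x,x^* )\mid f(x,x^* )=\langle x,x^*\rangle\}$. Conventions: $\sup\emptyset=-\infty$, $\inf\emptyset=+\infty$. *)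

(* Defs.v *)
From HB Require Import structures.
From mathcomp Require Import all_boot all_order all_algebra.
From mathcomp Require Import all_classical all_reals all_analysis.

Set Implicit Arguments.
Unset Strict Implicit.
Unset Printing Implicit Defensive.

Import Order.TTheory GRing.Theory Num.Theory.
Import numFieldNormedType.Exports.

Local Open Scope classical_set_scope.
Local Open Scope ring_scope.

Section Dual.
Context {R : realType} (X : normedModType R).

Definition dual_pred : {pred X -> R^o} :=
  fun f => `[< linear f /\ continuous f >].

Lemma dual_predP f : reflect (linear f /\ continuous f) (f \in dual_pred).
Proof. by rewrite unfold_in; exact: asboolP. Qed.

Lemma dual_pred_submod_closed : submod_closed dual_pred.
Proof.
split=> [|a f g /dual_predP[lf cf] /dual_predP[lg cg]]; apply/dual_predP; split.
- by move=> b x y; rewrite -[RHS]/(b *: (0 : R^o) + 0) scaler0 addr0.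
- exact: cst_continuous.
- move=> b x y; rewrite -[LHS]/(a *: f (b *: x + y) + g (b *: x + y)).
  rewrite -[RHS]/(b *: (a *: f x + g x) + (a *: f y + g y)).
  rewrite lf lg !scalerDr !scalerA (mulrC a b).
  by rewrite -!addrA; congr (_ + _); rewrite addrCA.
- by move=> x; apply: cvgD; [apply: cvgZ; [exact: cvg_cst|exact: cf]|exact: cg].
Qed.

HB.instance Definition _ :=
  GRing.isSubmodClosed.Build R (X -> R^o) dual_pred dual_pred_submod_closed.

Record dual := Dual { dual_fun :> X -> R^o ; _ : dual_fun \in dual_pred }.

HB.instance Definition _ := [isSub for dual_fun].
HB.instance Definition _ := [Choice of dual by <:].
HB.instance Definition _ := [SubChoice_isSubLmodule of dual by <:].

(* The topology carried by [dual] is the weak-star one: the topology of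
   pointwise convergence on X. The dual norm is kept separate (dual_norm). *)
HB.instance Definition _ := Topological.copy dual
  (initial_topology (dual_fun : dual -> {ptws X -> R^o})).

Lemma dual_continuous (xs : dual) : continuous xs.
Proof. by case: xs => f /= /dual_predP[]. Qed.

Lemma dual_linear (xs : dual) : linear xs.
Proof. by case: xs => f /= /dual_predP[]. Qed.

HB.instance Definition _ (xs : dual) :=
  GRing.isLinear.Build R X R^o _ (dual_fun xs) (dual_linear xs).

(* The set is bounded because xs is continuous, so [sup] is a genuine supremum. *)
Definition dual_norm (xs : dual) : R :=
  sup [set `|xs x| | x in [set x : X | `|x| <= 1]].

End Dual.

Section ConvexGeometry.
Context {R : realType} {X : normedModType R}.
Implicit Types (S C : set X).

Definition is_affine S := forall (x y : X) (t : R),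
  S x -> S y -> S (t *: x + (1 - t) *: y).

Definition affine_hull S : set X := smallest is_affine S.

(* Interior of S in the subspace topology of the closed affine hull. *)
Definition ri S : set X :=
  [set x | S x /\ within (closure (affine_hull S)) (nbhs x) S].

Definition nearly_convex S := exists C,
  [/\ convex_set C, ri C !=set0, C `<=` S & S `<=` closure C].

Definition tangent_cone C (x : X) : set X :=
  closure (\bigcup_(h in [set h : R | 0 < h]) [set h *: (y - x) | y in C]).

Definition normal_cone C (x : X) : set (dual X) :=
  [set xs | C x /\ forall y, C y -> xs (y - x) <= 0].

End ConvexGeometry.

Section Nets.
Context {I : Type}.

Definition directed (le : I -> I -> Prop) :=
  [/\ inhabited I, forall i, le i i,
      forall i j k, le i j -> le j k -> le i k
    & forall i j, exists k, le i k /\ le j k].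

(* A net u indexed by (I, le) converges to l iff  u @ net_filter le --> l. *)
Definition net_filter (le : I -> I -> Prop) : set_system I :=
  filter_from [set: I] (fun i0 => [set i | le i0 i]).

End Nets.

Section Operators.
Context {R : realType} {X : normedModType R}.
Implicit Types T S : X -> set (dual X).

Definition graph T : set (X * dual X) := [set z | T z.1 z.2].

Definition dom T : set X := [set x | T x !=set0].

Definition op_add T S : X -> set (dual X) :=
  fun x => [set xs + ys | xs in T x & ys in S x].

Definition monotone_op T := forall x1 x2 (xs1 xs2 : dual X),
  T x1 xs1 -> T x2 xs2 -> 0 <= (xs1 - xs2) (x1 - x2).

Definition maximal_monotone T :=
  monotone_op T /\
  forall S, monotone_op S -> graph T `<=` graph S -> graph S = graph T.

Definition convex_valued T := forall x, convex_set (T x).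

Definition demiclosed T :=
  forall (I : Type) (le : I -> I -> Prop) (x : I -> X) (xs : I -> dual X)
         (x0 : X) (xs0 : dual X),
    directed le ->
    (forall i, T (x i) (xs i)) ->
    x @ net_filter le --> x0 ->
    xs @ net_filter le --> xs0 ->
    (exists M : R, forall i, dual_norm (xs i) <= M) ->
    T x0 xs0.

Definition proper_fun (f : X * dual X -> \bar R) :=
  (forall z, f z != -oo%E) /\ exists z, f z != +oo%E.

Definition convex_efun (f : X * dual X -> \bar R) :=
  forall (z w : X * dual X) (t : R), 0 < t -> t < 1 ->
    (f (t *: z + (1 - t) *: w)%R <= t%:E * f z + (1 - t)%:E * f w)%E.

Definition representable T := exists f : X * dual X -> \bar R,
  [/\ proper_fun f, convex_efun f, lower_semicontinuous f,
      forall x (xs : dual X), ((xs x)%:E <= f (x, xs))%E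
    & graph T = [set z | f z = (z.2 z.1)%:E]].

(* ereal_sup set0 = -oo and ereal_inf set0 = +oo; in particular the right-hand
   side below is -oo when x is not in dom T. *)
Definition condition_H T :=
  (forall x, dom T x -> closed (T x) /\ convex_set (T x)) /\
  forall x v, closure (dom T) x -> ri (tangent_cone (closure (dom T)) x) v ->
    (ereal_inf [set ereal_inf [set (xs v)%:E | xs in T (x + h *: v)%R]
               | h in [set h : R | (0 < h)%R]]
     <= ereal_sup [set (xs v)%:E | xs in T x])%E.

Definition condition_D T := convex_valued T /\ demiclosed T.

Definition condition_R T := representable T.

End Operators.

(* Dimension greater than one, possibly infinite. *)
Definition dim_gt1 (R : realType) (X : normedModType R) :=
  exists x y : X, forall a b : R, a *: x + b *: y = 0 -> a = 0 /\ b = 0.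

(* Main.v *)
Require Import Defs.
From HB Require Import structures.
From mathcomp Require Import all_boot all_order all_algebra.
From mathcomp Require Import all_classical all_reals all_analysis.
From mathcomp Require Import ring lra.

(* For a maximal monotone T, monotonically related pairs give T = T + N_{D(T)}
   and (D), and the Fitzpatrick function gives (R); lower semicontinuity along
   bounded nets gives (R) => (D).  Let Y be the direction of the closed affine
   hull of D(T).

   (D) => (H): if v is in the relative interior of the tangent cone at x, then
   x + h v is relatively interior to D(T) for small h > 0, where T is locally
   bounded.  A lower bound on <v, ys> for ys in T(x + h v) then bounds ys on Y
   uniformly as h -> 0; after a norm-preserving extension from Y (which stays in
   T(x + h v), as T absorbs normal cones), a weak-star cluster point lies in T(x).
   The same bound with h = 0 shows that T(x) is weak-star closed.

   (H) => maximality: let (x, xs) be monotonically related to T.  Since T absorbs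
   normal cones, x - a is tangent at every a in D(T); (H) at the last point of
   cl D(T) on a segment towards x forces x in cl D(T).  If xs is not in T(x), some
   v0 separates it strictly from T(x); v0 is tangent at x by polarity, and moving
   it slightly into the relative interior of the tangent cone contradicts (H). *)

Set Implicit Arguments.
Unset Strict Implicit.
Unset Printing Implicit Defensive.

Import Order.TTheory GRing.Theory Num.Theory.
Import numFieldNormedType.Exports.

Local Open Scope classical_set_scope.
Local Open Scope ring_scope.

(** * Hahn-Banach theorem *)

Section HahnBanach.
Context {R : realType} {V : lmodType R}.
Implicit Types (p q f : V -> R) (S : set (V * R)).

(** Homogeneity is required only as an inequality for t > 0; using it at the inverse of t gives
    equality. *)
Definition sublinear p :=
  (forall u v, p (u + v) <= p u + p v) /\
  (forall t u, 0 < t -> p (t *: u) <= t * p u).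

Lemma sublinear0 p : sublinear p -> p 0 = 0.
Proof.
move=> [_ pZ]; apply/eqP; rewrite eq_le; apply/andP; split.
- by have := pZ 2^-1 0; rewrite scaler0 => /(_ _) h; have := h ltac:(lra); lra.
- by have := pZ 2 0; rewrite scaler0 => /(_ _) h; have := h ltac:(lra); lra.
Qed.

Lemma sublinear_geN p u v : sublinear p -> - p (- u) <= p (u + v) - p v.
Proof.
move=> sp; have := sp.1 (- u) (u + v); rewrite addKr; lra.
Qed.

(** The bound - p (- u) keeps every infimum finite. The index may vary in the last two hypotheses,
    which covers both infima over a cone and infima of chains. *)
Lemma sublinear_inf (I : Type) (D : set I) (g : I -> V -> R) p :
  D !=set0 ->
  (forall i u, D i -> - p (- u) <= g i u) ->
  (forall i j u v, D i -> D j -> exists k, D k /\ g k (u + v) <= g i u + g j v) ->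
  (forall i t u, D i -> 0 < t -> exists k, D k /\ g k (t *: u) <= t * g i u) ->
  sublinear (fun u => inf [set g i u | i in D]) /\
  forall i u, D i -> inf [set g j u | j in D] <= g i u.
Proof.
move=> [i0 Di0] gp gD gZ.
have lb i u : D i -> inf [set g j u | j in D] <= g i u.
  move=> Di; apply: ge_inf; last by exists i.
  by exists (- p (- u)) => _ [j Dj <-]; exact: gp.
split=> //; split=> [u v|t u t0].
- rewrite -lerBlDr. apply: lb_le_inf; first by exists (g i0 u), i0.
  move=> _ [i Di <-]; rewrite lerBlDr -lerBlDl.
  apply: lb_le_inf; first by exists (g i0 v), i0.
  move=> _ [j Dj <-]; rewrite lerBlDl.
  by have [k [Dk]] := gD i j u v Di Dj; apply: le_trans; exact: lb.
- rewrite -ler_pdivrMl//; apply: lb_le_inf; first by exists (g i0 u), i0.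
  move=> _ [i Di <-]; rewrite ler_pdivrMl//.
  by have [k [Dk]] := gZ i t u Di t0; apply: le_trans; exact: lb.
Qed.

(** A pair (a, c) in such a cone encodes the constraint 0 <= f a + c on the functional f to be
    found. *)
Definition cone S :=
  [/\ S (0, 0), (forall a b, S a -> S b -> S (a.1 + b.1, a.2 + b.2))
    & forall t a, 0 < t -> S a -> S (t *: a.1, t * a.2)].

(** The witness is the infimum of p (u + a) + c over the pairs (a, c) in S. At u = - a it is at most
    c, which forces the constraint on every linear minorant. *)
Lemma sublinear_cone_inf p S : sublinear p -> cone S ->
  (forall a, S a -> 0 <= p a.1 + a.2) ->
  exists q, [/\ sublinear q, (forall u, q u <= p u)
    & forall a u, S a -> q u <= p (u + a.1) + a.2].
Proof.
move=> sp [S0 SD SZ] pS.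
have [||||sq qle] := @sublinear_inf _ S (fun a u => p (u + a.1) + a.2) p.
- by exists (0, 0).
- by move=> a u Sa; have := pS _ Sa; have := sublinear_geN u a.1 sp; lra.
- move=> a b u v Sa Sb; exists (a.1 + b.1, a.2 + b.2); split; first exact: SD.
  by rewrite /= addrACA; have := sp.1 (u + a.1) (v + b.1); lra.
- move=> a t u Sa t0; exists (t *: a.1, t * a.2); split; first exact: SZ.
  by rewrite /= -scalerDr; have := sp.2 t (u + a.1) t0; lra.
exists (fun u => inf [set p (u + a.1) + a.2 | a in S]); split=> // u.
by have := qle (0, 0) u S0; rewrite /= !addr0.
Qed.

Lemma minimal_sublinear p : sublinear p -> exists q,
  [/\ sublinear q, (forall u, q u <= p u)
    & forall r, sublinear r -> (forall u, r u <= q u) -> r = q].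
Proof.
move=> sp; pose T := {q : V -> R | sublinear q /\ forall u, q u <= p u}.
(* The order is reversed: maximal elements are minimal functionals, and a chain is bounded by its
   infimum. *)
pose r (a b : T) := `[< forall u, sval b u <= sval a u >].
have [|||A totA|[q [sq qp]] qmin] := @Zorn T r.
- by move=> a; apply/asboolP.
- move=> a b c /asboolP ab /asboolP bc; apply/asboolP => u.
  exact: le_trans (bc u) (ab u).
- move=> [a Pa] [b Pb] /asboolP/= ab /asboolP/= ba; apply: eq_exist.
  by apply/funext => u; apply/eqP; rewrite eq_le ab ba.
(* The empty chain has no pointwise infimum and is bounded by [p] itself. *)
- have [->|/set0P A0] := eqVneq A set0.
    by exists (exist (fun q => sublinear q /\ forall u, q u <= p u) p
      (conj sp (fun u => lexx (p u)))).
  have [||||si ile] := @sublinear_inf _ A (fun a u => sval a u) p.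
  + by [].
  + move=> [a [sa ap]] u _ /=; have := sublinear_geN u 0 sa.
    by rewrite addr0 (sublinear0 sa); have := ap (- u); lra.
  + move=> a b u v Aa Ab; have [/asboolP ab|/asboolP ba] := totA a b Aa Ab.
    * exists b; split=> //; have := (svalP b).1.1 u v; have := ab u; lra.
    * exists a; split=> //; have := (svalP a).1.1 u v; have := ba v; lra.
  + by move=> a t u Aa t0; exists a; split=> //; exact: (svalP a).1.2.
  have ip u : inf [set sval a u | a in A] <= p u.
    by have [a Aa] := A0; exact: le_trans (ile a u Aa) ((svalP a).2 u).
  exists (exist (fun q => sublinear q /\ forall u, q u <= p u) _ (conj si ip)).
  by move=> a Aa; apply/asboolP => u; exact: ile.
exists q; split=> // s ss sq'.
have sp' u : s u <= p u by exact: le_trans (sq' u) (qp u).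
have := qmin (exist (fun q => sublinear q /\ forall u, q u <= p u) s (conj ss sp')).
by move=> /(_ _)/(congr1 sval)/= ->//; apply/asboolP.
Qed.

(* A minimal sublinear functional q is additive: for fixed a, the sublinear
   functional u |-> inf_{t >= 0} q(u + t a) - t q(a) is below q, hence equals q. *)
Lemma sublinear_ge_linear p : sublinear p ->
  exists f, linear (f : V -> R^o) /\ forall u, f u <= p u.
Proof.
move=> /minimal_sublinear[q [sq qp qmin]]; exists q; split=> //.
have qZ t u : 0 <= t -> q (t *: u) = t * q u.
  rewrite le_eqVlt => /predU1P[<-|t0]; first by rewrite scale0r mul0r sublinear0.
  apply/eqP; rewrite eq_le sq.2//= -ler_pdivlMl//.
  by rewrite -[X in q X <= _](scalerK (lt0r_neq0 t0)) sq.2// invr_gt0.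
have qD u a : q (u + a) = q u + q a.
  apply/eqP; rewrite eq_le sq.1 /=.
  pose S := [set (t *: a, - (t * q a)) | t in [set t : R | 0 <= t]].
  have [||r [sr rq rS]] := @sublinear_cone_inf q S sq.
  - split.
    + by exists 0 => /=; rewrite ?scale0r ?mul0r ?oppr0.
    + move=> _ _ [s /= s0 <-] [t /= t0 <-]; exists (s + t) => /=.
        exact: addr_ge0.
      by rewrite scalerDl mulrDl opprD.
    + move=> t _ t0 [s /= s0 <-]; exists (t * s) => /=.
        by rewrite mulr_ge0// ltW.
      by rewrite scalerA mulrN mulrA.
  - by move=> _ [t /= t0 <-]; rewrite qZ// subrr.
  have rE := qmin r sr rq; rewrite rE in rS.
  have S1 : S (a, - q a) by exists 1; rewrite /= ?scale1r ?mul1r.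
  by have := rS _ u S1; rewrite /= lerBrDr.
have qN u : q (- u) = - q u.
  by have := qD u (- u); rewrite subrr (sublinear0 sq); lra.
move=> t u v; rewrite qD; congr (_ + _).
have [t0|t0] := leP 0 t; first exact: qZ.
by rewrite -[t in LHS]opprK scaleNr qN qZ ?mulNr ?opprK// oppr_ge0 ltW.
Qed.

(** A linear minorant of the functional from [sublinear_cone_inf], evaluated at - a.1, satisfies the
    constraint. The extension and separation results below arise from suitable choices of S. *)
Theorem hahn_banach_cone p S : sublinear p -> cone S ->
  (forall a, S a -> 0 <= p a.1 + a.2) ->
  exists f, [/\ linear (f : V -> R^o), (forall u, f u <= p u)
    & forall a, S a -> 0 <= f a.1 + a.2].
Proof.
move=> sp cS pS; have [q [sq qp qS]] := sublinear_cone_inf sp cS pS.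
have [f [lf fq]] := sublinear_ge_linear sq.
exists f; split=> // [u|a Sa]; first exact: le_trans (fq u) (qp u).
have := le_trans (fq _) (qS a (- a.1) Sa); rewrite addNr (sublinear0 sp) add0r.
have -> : f (- a.1) = - f a.1.
  have := lf (-1) a.1 0; have := lf (-1) 0 0.
  rewrite !scaleN1r !addr0 oppr0 -[RHS]/(- f 0 + f 0).
  by rewrite -[X in _ -> _ = X -> _]/(- f a.1 + f 0); lra.
lra.
Qed.

End HahnBanach.

(** * Weak-star topology of the dual *)

Section DualSpace.
Context {R : realType} {X : normedModType R}.
Implicit Types (xs ys l : dual X) (u : X).

Definition dual_bounded (M : R) xs := forall u, `|xs u| <= M * `|u|.

Lemma dual_of_bounded (f : X -> R) (M : R) : linear (f : X -> R^o) ->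
  (forall u, f u <= M * `|u|) -> exists2 xs : dual X, xs =1 f & dual_bounded M xs.
Proof.
move=> lf fM.
pose g : {linear X -> R^o} := HB.pack (f : X -> R^o) (GRing.isLinear.Build _ _ _ _ _ lf).
have fM' u : `|g u| <= M * `|u|.
  by rewrite ler_norml lerNl -linearN -{1}(normrN u) !fM.
have gc : continuous (g : X -> R^o).
  apply: bounded_linear_continuous; apply/linear_boundedP.
  exists M; split=> [|r /ltW Mr x]; first exact: num_real.
  by rewrite (le_trans (fM' x))// ler_wpM2r.
have gP : (f : X -> R^o) \in @dual_pred R X by apply/dual_predP; split.
by exists (Dual gP).
Qed.

Lemma dual_bounded_ex xs : exists2 M, 0 < M & dual_bounded M xs.
Proof.
have /linear_bounded_continuous/linear_boundedP := @dual_continuous _ _ xs.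
by move=> /pinfty_ex_gt0[M M0 HM]; exists M.
Qed.

Lemma dual_norm_le xs M : 0 <= M -> dual_bounded M xs -> dual_norm xs <= M.
Proof.
move=> M0 xsM; apply: ge_sup; first by exists `|xs 0|, 0; rewrite //= normr0.
by move=> _ [u /= u1 <-]; rewrite (le_trans (xsM u))// ler_piMr.
Qed.

Lemma dual_bounded_norm xs M : dual_norm xs <= M -> dual_bounded M xs.
Proof.
move=> xsM u; have [->|u0] := eqVneq u 0; first by rewrite linear0 !normr0 mulr0.
have nu0 : 0 < `|u| by rewrite normr_gt0.
suff : `|xs (`|u|^-1 *: u)| <= M.
  rewrite linearZ /= normrZ normfV normr_id ler_pdivrMl//.
  by rewrite mulrC.
apply: le_trans xsM; apply: ub_le_sup.
  have [K K0 xsK] := dual_bounded_ex xs; exists K => _ [v /= v1 <-].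
  by rewrite (le_trans (xsK v))// ler_piMr// ltW.
exists (`|u|^-1 *: u) => //=.
by rewrite normrZ normfV normr_id mulVf// gt_eqF.
Qed.

Lemma dual_eval_continuous u : continuous (fun xs => xs u : R).
Proof.
move=> xs.
have h1 := @initial_continuous _ {ptws X -> R^o} (@dual_fun R X) xs.
have h2 := @proj_continuous X (fun=> R^o) u (dual_fun xs).
by have := continuous_comp h1 h2.
Qed.

Lemma dual_cvgP (F : set_system (dual X)) l : Filter F ->
  (F --> l) <-> forall u, (fun xs => xs u : R) @ F --> (l u : R).
Proof.
move=> FF; split=> [Fl u|Fl].
  apply: cvg_trans; last exact: (@dual_eval_continuous u l).
  exact: cvg_app.
have Fl' : (@dual_fun R X : dual X -> {ptws X -> R^o}) @ F --> (dual_fun l : {ptws X -> R^o}).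
  apply/cvg_sup => u A [_ [[C oC <-] Cl CA]].
  rewrite nbhs_filterE; apply: filterS CA _.
  apply: (Fl u); exact: open_nbhs_nbhs.
move=> A [_ [[C oC <-] Cl CA]]; rewrite nbhs_filterE; apply: filterS CA _.
by apply: Fl'; exact: open_nbhs_nbhs.
Qed.

(** Banach-Alaoglu along an ultrafilter: each value at u stays in a compact segment, hence
    converges, and the pointwise limit is linear and bounded. *)
Lemma dual_ultra_cvg (I : Type) (G : set_system I) (xs : I -> dual X) (M : R) :
  UltraFilter G -> G [set i | dual_bounded M (xs i)] ->
  exists l, xs @ G --> l.
Proof.
move=> UG GM.
have cvgu u : exists c : R, (fun i => xs i u : R) @ G --> c.
  have cpt := @segment_compact R (- (M * `|u|)) (M * `|u|).
  have [|c [_ clc]] := cpt ((fun i => xs i u : R) @ G) _.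
    rewrite /fmap /=; apply: filterS GM => i /(_ u).
    by rewrite ler_norml /= in_itv.
  exists c => B Bc; have [//|GnB] := in_ultra_setVsetC ((fun i => xs i u) @^-1` B) UG.
  by have [y [ny By]] := clc (~` B) B GnB Bc.
pose f u := sval (cid (cvgu u)).
have fP u : (fun i => xs i u : R) @ G --> f u by rewrite /f; case: cid.
have lf : linear (f : X -> R^o).
  move=> a u v; apply: (cvg_unique _ (fP _)) => //.
  rewrite (_ : (fun i => _) = (fun i => (a *: (xs i u : R^o) + xs i v) : R^o)).
    by apply: cvgD; [apply: cvgZ; [exact: cvg_cst|exact: fP]|exact: fP].
  by apply/funext => i; rewrite linearP.
have fM u : f u <= M * `|u|.
  apply: (cvgr_to_le (fP u)).
  by near=> i; apply: le_trans (ler_norm _) _; near: i; apply: filterS GM => i.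
have [l lE _] := dual_of_bounded lf fM.
exists l; apply/dual_cvgP => u.
by rewrite lE; exact: fP.
Unshelve. all: by end_near. Qed.

(** The filter becomes a net indexed by pairs (A, i) with A in G and i in A, ordered by reverse
    inclusion. Only good indices i are kept, since demiclosedness asks every member of the net to
    lie in T and be bounded. *)
Lemma demiclosed_filter (T : X -> set (dual X)) (I : Type) (G : set_system I)
    (x : I -> X) (xs : I -> dual X) x0 l M : demiclosed T -> ProperFilter G ->
  G [set i | T (x i) (xs i)] -> x @ G --> x0 -> xs @ G --> l ->
  G [set i | dual_norm (xs i) <= M] -> T x0 l.
Proof.
move=> demT PG GT xx0 xsl GM.
pose good := [set i | T (x i) (xs i) /\ dual_norm (xs i) <= M].
have Ggood : G good by exact: filterI GT GM.
pose J := {p : set I * I | [/\ G p.1, p.1 p.2 & good p.2]}.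
pose le (p q : J) := (sval q).1 `<=` (sval p).1.
have J_of (A : set I) : G A -> exists j : J, (sval j).1 = A.
  move=> GA; have [i [Ai gi]] := filter_ex (filterI GA Ggood).
  by exists (exist (fun p => [/\ G p.1, p.1 p.2 & good p.2]) (A, i) (And3 GA Ai gi)).
have tail (A : set I) : G A -> net_filter le [set j : J | A (sval j).2].
  move=> GA; have [j jA] := J_of A GA; exists j => // k /=.
  by rewrite /le jA => kA; apply: kA; case: (svalP k).
apply: (demT J le (fun j => x (sval j).2) (fun j => xs (sval j).2)).
- split.
  + by have [j _] := J_of setT filterT; constructor.
  + by move=> j A.
  + by move=> i j k ij jk; exact: subset_trans jk ij.
  + move=> i j; have [Gi _ _] := svalP i; have [Gj _ _] := svalP j.
    have [k kE] := J_of _ (filterI Gi Gj); exists k.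
    by rewrite /le kE; split=> a [].
- by move=> j; have [_ _ []] := svalP j.
- by move=> A /xx0; rewrite /fmap /= => /tail.
- by move=> A /xsl; rewrite /fmap /= => /tail.
- by exists M => j; have [_ _ []] := svalP j.
Qed.

End DualSpace.

(** * Uniform boundedness on a closed subspace *)

Section UniformBoundedness.
Context {R : realType} {X : completeNormedModType R}.
Implicit Types (Y : set X) (T : X -> set (dual X)).

Definition subspace (Y : set X) :=
  Y 0 /\ forall (a : R) u v, Y u -> Y v -> Y (a *: u + v).

(** Baire's theorem inside Y: closed balls are nested with radii at least halved at each step, and
    their centres converge in Y by completeness. *)
Lemma baire_closed Y (U : nat -> set X) x0 : closed Y -> Y x0 ->
  (forall n x r, Y x -> 0 < r -> exists x' r', [/\ Y x', 0 < r',
     `|x' - x| + r' <= r & forall z, Y z -> `|z - x'| <= r' -> U n z]) ->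
  exists z, Y z /\ forall n, U n z.
Proof.
move=> cY Yx0 step.
pose P n (a b : X * R) := Y a.1 -> 0 < a.2 -> [/\ Y b.1, 0 < b.2,
  `|b.1 - a.1| + b.2 <= a.2 / 2 & forall z, Y z -> `|z - b.1| <= b.2 -> U n z].
have /choice[g gP] : forall na : nat * (X * R), exists b, P na.1 na.2 b.
  move=> [n [x r]] /=; have [[Yx r0]|nYr] := pselect (Y x /\ 0 < r).
    have [//|x' [r' [Yx' r'0 xr' Ur']]] := step n x (r / 2) Yx; first by lra.
    by exists (x', r') => _ _; split.
  by exists (x, r) => Yx r0; exfalso; apply: nYr.
pose s := fix s n := if n is m.+1 then g (m, s m) else (x0, 1).
have sP n : Y (s n).1 /\ 0 < (s n).2.
  elim: n => [|n [Yn rn]] /=; first by split.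
  by have [] := gP (n, s n) Yn rn.
have sS n : [/\ `|(s n.+1).1 - (s n).1| + (s n.+1).2 <= (s n).2 / 2
    & forall z, Y z -> `|z - (s n.+1).1| <= (s n.+1).2 -> U n z].
  by have [] := gP (n, s n) (sP n).1 (sP n).2.
have r0 n : 0 < (s n).2 by case: (sP n).
have rle n : (s n).2 <= 2^-1 ^+ n.
  elim: n => [|n IHn]; first by rewrite expr0.
  have [+ _] := sS n; rewrite exprS.
  by have := normr_ge0 ((s n.+1).1 - (s n).1); lra.
have dist n k : `|(s (n + k)%N).1 - (s n).1| <= (s n).2 - (s (n + k)%N).2.
  elim: k => [|k IHk]; first by rewrite addn0 !subrr normr0.
  rewrite addnS; have [h _] := sS (n + k)%N; have := r0 (n + k)%N.
  have := ler_distD (s (n + k)%N).1 (s (n + k).+1).1 (s n).1.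
  by lra.
have dist' n k : (n <= k)%N -> `|(s k).1 - (s n).1| <= (s n).2.
  by move=> /subnKC <-; have := dist n (k - n)%N; have := r0 (n + (k - n))%N; lra.
have cvgs : cvg ((fun n => (s n).1) @ \oo).
  apply/cauchy_cvgP/cauchy_exP => e e0.
  have [n _ nP] : \forall n \near \oo, (2^-1 : R) ^+ n < e.
    have := @cvg_expr R 2^-1; rewrite gtr0_norm; last by lra.
    move=> /(_ ltac:(lra))/cvgr_lt; exact.
  exists (s n).1; exists n => // k /= nk.
  rewrite -ball_normE /= distrC; apply: le_lt_trans (dist' n k nk) _.
  by apply: le_lt_trans (rle n) _; apply: nP => /=.
pose z := lim ((fun n => (s n).1) @ \oo).
have sz : (fun n => (s n).1) @ \oo --> z by [].
have Yz : Y z.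
  by apply: (closed_cvg Y cY _ _ sz); apply: nearW => n; case: (sP n).
(* The ball contained in U n is the one of index n + 1, and the limit stays in it. *)
exists z; split=> // n; have [_] := sS n; apply=> //.
have : (fun k => `|(s k).1 - (s n.+1).1|) @ \oo --> `|z - (s n.+1).1|.
  by apply: cvg_norm; apply: cvgB sz _; exact: cvg_cst.
move=> /cvgr_to_le; apply; exists n.+1 => // k /= nk.
exact: (dist' n.+1 k nk).
Qed.

Definition bounded_on Y (M : R) (xs : dual X) := forall u, Y u -> `|xs u| <= M * `|u|.

(** Banach-Steinhaus on Y: without a uniform bound, the points where some member of F exceeds n fill
    a ball inside every ball of Y, and Baire's theorem yields a point where F is unbounded. *)
Lemma uniform_boundedness Y (F : set (dual X)) : closed Y -> subspace Y ->
  (forall u, Y u -> exists K, forall xs, F xs -> `|xs u| <= K) ->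
  exists2 M, 0 < M & forall xs, F xs -> bounded_on Y M xs.
Proof.
move=> cY [Y0 YZ] FK; apply: contrapT => nM.
have YD u v : Y u -> Y v -> Y (u + v).
  by move=> Yu Yv; rewrite -[u]scale1r; exact: YZ.
have YS a u : Y u -> Y (a *: u) by move=> Yu; rewrite -[_ *: _]addr0; exact: YZ.
have [|z [Yz zU]] := @baire_closed Y (fun n z => exists2 xs, F xs & n%:R < `|xs z|) 0 cY Y0.
  move=> n x r Yx r0.
  have [[x' [xs [Yx' xx' Fxs nxs]]]|nx] := pselect (exists x' xs,
      [/\ Y x', `|x' - x| < r, F xs & n%:R < `|xs x'|]).
    have [K K0 xsK] := dual_bounded_ex xs.
    (* The second bound keeps the variation of [xs] around x', at most K r', within half of its
       excess over n at x'. *)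
    pose r' := Num.min (r - `|x' - x|) ((`|xs x'| - n%:R) / (2 * K)).
    have r'1 : r' <= r - `|x' - x| by rewrite ge_min lexx.
    have r'2 : r' <= (`|xs x'| - n%:R) / (2 * K) by rewrite ge_min lexx orbT.
    exists x', r'; split=> //.
    - by rewrite lt_min; apply/andP; split; [lra|apply: divr_gt0; lra].
    - by lra.
    - move=> z Yz zx'; exists xs => //.
      have := xsK (z - x'); rewrite linearB /= => h.
      have : K * `|z - x'| <= (`|xs x'| - n%:R) / 2.
        rewrite -ler_pdivlMl// (le_trans zx')// (le_trans r'2)//.
        by rewrite invfM mulrA mulrC.
      have := ler_normD (xs x' - xs z : R) (xs z : R); rewrite subrK distrC.
      by lra.
  exfalso; apply: nM.
  (* Here F is bounded by n on the ball of Y of radius r about x, so differences bound it by 2 n at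
     vectors of norm r / 2. The extra 1 keeps the constant positive. *)
  exists (2 * (n%:R + 1) / (r / 2)).
    by rewrite divr_gt0 ?mulr_gt0 ?ltr_wpDl//; lra.
  move=> xs Fxs u Yu; have [->|u0] := eqVneq u 0.
    by rewrite linear0 !normr0 mulr0.
  have nu0 : 0 < `|u| by rewrite normr_gt0.
  pose t := r / 2 / `|u|; have t0 : 0 < t by rewrite divr_gt0//; lra.
  have xsn x' : Y x' -> `|x' - x| < r -> `|xs x'| <= n%:R.
    by move=> Yx' xx'; rewrite leNgt; apply/negP => nxs; apply: nx; exists x', xs.
  have h1 := xsn x Yx; rewrite subrr normr0 in h1.
  have h2 : `|xs (x + t *: u)| <= n%:R.
    apply: xsn; first by apply: YD => //; exact: YS.
    by rewrite addrC addKr normrZ gtr0_norm// divfK ?gt_eqF//; lra.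
  have h3 : t * `|xs u| <= 2 * (n%:R + 1).
    rewrite -(gtr0_norm t0) -normrM.
    have -> : t * xs u = xs (x + t *: u) - xs x by rewrite linearD linearZ /= addrC addKr.
    by have := ler_normB (xs (x + t *: u)) (xs x); have := h1 r0; lra.
  rewrite (_ : _ * `|u| = 2 * (n%:R + 1) / t); last first.
    by rewrite /t [in RHS]invf_div mulrAC mulrA.
  by rewrite ler_pdivlMr// mulrC.
have [K FKz] := FK z Yz.
have [xs Fxs] := zU (Num.truncn K).+1.
have := FKz xs Fxs; have := truncnS_gt K; lra.
Qed.

(** This k is the norm of xs restricted to Y; its minimality is what later allows a bound in terms
    of k itself to be absorbed. *)
Lemma best_bound_on Y (xs : dual X) : exists k,
  [/\ 0 <= k, bounded_on Y k xs & forall k', 0 <= k' -> bounded_on Y k' xs -> k <= k'].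
Proof.
pose V := [set k | 0 <= k /\ bounded_on Y k xs].
have V0 : V !=set0.
  by have [M M0 xsM] := dual_bounded_ex xs; exists M; split=> [|u _]; [exact: ltW|].
have lb k : V k -> inf V <= k.
  by move=> Vk; apply: ge_inf => //; exists 0 => j [].
exists (inf V); split.
- by apply: lb_le_inf => // k [].
- move=> u Yu; have [->|u0] := eqVneq u 0; first by rewrite linear0 !normr0 mulr0.
  rewrite -ler_pdivrMr ?normr_gt0//; apply: lb_le_inf => // k [k0 xsk].
  by rewrite ler_pdivrMr ?normr_gt0//; exact: xsk.
- by move=> k k0 xsk; exact: lb.
Qed.

(** The direction Y is fixed and the radius explicit, which is easier to transport along segments
    than [ri]. *)
Definition rel_interior Y (S : set X) (e : X) :=
  exists2 r, 0 < r & forall z, Y z -> `|z| < r -> S (e + z).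

(* The weight 1 + k |y - e|, k the norm of ys on Y, turns monotonicity into
   pointwise boundedness; it is absorbed for y close to e. *)
Lemma monotone_locally_bounded T Y e : monotone_op T -> closed Y -> subspace Y ->
  (forall y, dom T y -> Y (y - e)) -> rel_interior Y (dom T) e ->
  exists d M, [/\ 0 < d, 0 < M & forall y ys, T y ys -> `|y - e| < d -> bounded_on Y M ys].
Proof.
move=> mT cY sY domY [r r0 er].
pose F := [set xs : dual X | exists y ys k, [/\ T y ys, `|y - e| <= 1, 0 <= k,
  bounded_on Y k ys & xs = (1 + k * `|y - e|)^-1 *: ys]].
have YS a u : Y u -> Y (a *: u).
  by move=> Yu; rewrite -[_ *: _]addr0; apply: sY.2 => //; exact: sY.1.
have half u : Y u -> exists2 K, 0 <= K & forall y ys k, T y ys -> `|y - e| <= 1 ->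
    0 <= k -> bounded_on Y k ys -> ys u <= K * (1 + k * `|y - e|).
  move=> Yu; pose t := r / (1 + `|u|).
  have t0 : 0 < t by rewrite divr_gt0// ltr_pwDl.
  have tu : `|t *: u| < r.
    rewrite normrZ gtr0_norm// /t mulrAC ltr_pdivrMr ?ltr_pwDl//.
    by rewrite ltr_pM2l//; lra.
  have [p Tp] := er (t *: u) (YS t u Yu) tu.
  have [P P0 pP] := dual_bounded_ex p.
  (* Monotonicity between y and e + t u gives t ys(u) <= P (r + 1) + k |y - e|, because |e + t u -
     y| <= r + 1. *)
  exists ((1 + P * (r + 1)) / t).
    by rewrite divr_ge0// ?addr_ge0 ?mulr_ge0 ?addr_ge0// ltW.
  move=> y ys k Ty ye k0 ysk.
  rewrite mulrAC ler_pdivlMr// mulrC.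
  have := mT _ _ _ _ Tp Ty.
  rewrite -[X in 0 <= X]/(p (e + t *: u - y) - ys (e + t *: u - y)).
  have -> : ys (e + t *: u - y) = t * ys u - ys (y - e).
    by rewrite addrAC linearD linearZ /= -opprB linearN /= addrC.
  have h1 := le_trans (ler_norm _) (ysk (y - e) (domY y (ex_intro _ ys Ty))).
  have h2 := le_trans (ler_norm _) (pP (e + t *: u - y)).
  have h3 : P * `|e + t *: u - y| <= P * (r + 1).
    rewrite ler_pM2l// addrAC addrC; apply: le_trans (ler_normD _ _) _.
    by rewrite (distrC e y); lra.
  have h4 : 0 <= P * (r + 1) * (k * `|y - e|).
    by rewrite !mulr_ge0 ?addr_ge0// ltW.
  by move=> h5; lra.
have [u Yu|M M0 FM] := @uniform_boundedness Y F cY sY.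
  have YNu : Y (- u) by rewrite -scaleN1r; exact: YS.
  have [K K0 HK] := half u Yu; have [K' K'0 HK'] := half (- u) YNu.
  exists (K + K') => _ [y [ys [k [Ty ye k0 ysk ->]]]].
  have w0 : 0 < 1 + k * `|y - e| by rewrite ltr_pwDl// mulr_ge0.
  rewrite -[X in `|X|]/((1 + k * `|y - e|)^-1 * ys u) normrM gtr0_norm ?invr_gt0//.
  rewrite ler_pdivrMl// ler_norml.
  have := HK y ys k Ty ye k0 ysk; have := HK' y ys k Ty ye k0 ysk; rewrite linearN /=.
  have : 0 <= K * (1 + k * `|y - e|) by rewrite mulr_ge0// ltW.
  have : 0 <= K' * (1 + k * `|y - e|) by rewrite mulr_ge0// ltW.
  by move=> *; apply/andP; split; lra.
(* For k the norm of ys on Y, the bound on F gives k <= M (1 + k |y - e|), and |y - e| < 1 / (2 M)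
   then gives k <= 2 M. *)
exists (Num.min 1 (2 * M)^-1), (2 * M); split.
- by rewrite lt_min ltr01 invr_gt0 mulr_gt0.
- by rewrite mulr_gt0.
move=> y ys Ty; rewrite lt_min => /andP[ye1 yeM] u Yu.
have [k [k0 ysk kmin]] := best_bound_on Y ys.
have w0 : 0 < 1 + k * `|y - e| by rewrite ltr_pwDl// mulr_ge0.
have yskM : bounded_on Y (M * (1 + k * `|y - e|)) ys.
  move=> v Yv; have := FM ((1 + k * `|y - e|)^-1 *: ys) _ v Yv.
  rewrite -[X in `|X| <= _]/((1 + k * `|y - e|)^-1 * ys v) normrM gtr0_norm ?invr_gt0//.
  rewrite ler_pdivrMl// mulrA [X in _ <= X * _]mulrC; apply.
  by exists y, ys, k; split=> //; exact: ltW.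
have kle := kmin _ (mulr_ge0 (ltW M0) (ltW w0)) yskM.
apply: le_trans (ysk u Yu) _; rewrite ler_wpM2r//.
have : k * (2 * M * `|y - e|) <= k * 1.
  rewrite ler_wpM2l// mulrC -ler_pdivlMr ?mulr_gt0// div1r; exact: ltW.
by lra.
Qed.

End UniformBoundedness.

(** * Relative interiors and tangent cones *)

Lemma convex_setP {R : realType} {V : lmodType R} (A : set V) :
  convex_set (A : set (convex_lmodType V)) <->
  forall (t : R) x y, 0 <= t -> t <= 1 -> A x -> A y -> A (t *: x + (1 - t) *: y).
Proof.
split=> [cA t x y t0 t1 Ax Ay|cA x y t /set_mem Ax /set_mem Ay].
  by have /set_mem := cA x y (Itv01 t0 t1) (mem_set Ax) (mem_set Ay).
by apply/mem_set; exact: cA.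
Qed.

(** * Closed convex cones and their separation from a point *)

Section Cones.
Context {R : realType} {X : normedModType R}.
Implicit Types (A S C D Y K : set X).

Lemma closure_normP A x :
  closure A x <-> forall e : R, 0 < e -> exists2 a, A a & `|a - x| < e.
Proof.
split=> [clA e e0|clA B /nbhs_ballP[e e0 eB]].
  have [a [Aa]] := clA _ (nbhsx_ballx x e e0).
  by rewrite -ball_normE /= distrC => ?; exists a.
have [a Aa ax] := clA e e0; exists a; split=> //; apply: eB.
by rewrite -ball_normE /= distrC.
Qed.

Definition convex_cone K :=
  [/\ K 0, forall u v, K u -> K v -> K (u + v)
    & forall (t : R) u, 0 < t -> K u -> K (t *: u)].

(** Hahn-Banach is applied to the norm, with the cone generated by (k, 0) for k in K and (- v, - e),
    where e > 0 is a lower bound for the distance from v to K. *)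
Lemma closed_cone_separation K v : convex_cone K -> closed K -> ~ K v ->
  exists xs : dual X, 0 < xs v /\ forall k, K k -> xs k <= 0.
Proof.
move=> [K0 KD KZ] cK nKv.
have [e e0 eK] : exists2 e : R, 0 < e & forall k, K k -> e <= `|k - v|.
  apply: contrapT => ne; apply: nKv; apply: cK; apply/closure_normP => e e0.
  apply: contrapT => nke; apply: ne; exists e => // k Kk.
  by rewrite leNgt; apply/negP => ke; apply: nke; exists k.
pose S := [set a : X * R | exists k t, [/\ K k, 0 <= t & a = (k - t *: v, - (t * e))]].
have [|||f [lf fle fS]] := @hahn_banach_cone _ _ (fun u => `|u|) S.
- split=> [u w|t u t0]; first exact: ler_normD.
  by rewrite normrZ gtr0_norm.
- split.
  + by exists 0, 0; rewrite scale0r mul0r subr0 oppr0.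
  + move=> _ _ [k [t [Kk t0 ->]]] [l [s [Kl s0 ->]]] /=.
    exists (k + l), (t + s); split; [exact: KD|exact: addr_ge0|].
    by rewrite scalerDl mulrDl !opprD addrACA.
  + move=> s _ s0 [k [t [Kk t0 ->]]] /=; exists (s *: k), (s * t); split.
    * exact: KZ.
    * by rewrite mulr_ge0// ltW.
    * by rewrite scalerBr scalerA mulrN mulrA.
- move=> _ [k [t [Kk t0 ->]]] /=; rewrite subr_ge0.
  move: t0; rewrite le_eqVlt => /predU1P[<-|t0]; first by rewrite mul0r.
  have -> : k - t *: v = t *: (t^-1 *: k - v).
    by rewrite scalerBr scalerA divff ?gt_eqF// scale1r.
  by rewrite normrZ gtr0_norm// ler_pM2l// eK//; apply: KZ => //; rewrite invr_gt0.
have [l lE _] := @dual_of_bounded _ _ f 1 lf (fun u => ltac:(by rewrite mul1r)).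
exists (- l); split=> [|k Kk].
  rewrite -[X in 0 < X]/(- l v).
  have := fS (0 - 1 *: v, - (1 * e)); rewrite /= scale1r mul1r sub0r.
  rewrite -(lE (- v)) linearN /= => h.
  suff : 0 <= - l v - e by lra.
  by apply: h; exists 0, 1; rewrite scale1r mul1r sub0r.
rewrite -[X in X <= 0]/(- l k) lE oppr_le0.
have := fS (k - 0 *: v, - (0 * e)); rewrite /= scale0r mul0r subr0 oppr0 addr0; apply.
by exists k, 0; rewrite scale0r mul0r subr0 oppr0.
Qed.

End Cones.

(** * Nearly convex sets and their closed affine hulls *)

Section NearlyConvex.
Context {R : realType} {X : completeNormedModType R}.
Implicit Types (A S C D Y K : set X).

(* Y is the direction of the closed affine hull of C. *)
Definition convex_frame Y C D c0 :=
  [/\ closed Y, subspace Y,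
      forall (t : R) x y, 0 <= t -> t <= 1 -> C x -> C y -> C (t *: x + (1 - t) *: y),
      C `<=` D /\ D `<=` closure C
    & rel_interior Y C c0 /\ forall c, C c -> Y (c - c0)].

Lemma closure_affine A : is_affine A -> is_affine (closure A).
Proof.
move=> aA x y t /closure_normP clx /closure_normP cly; apply/closure_normP => e e0.
have w0 (s : R) : 0 < 2 * (1 + `|s|) by rewrite mulr_gt0// ltr_pwDl.
(* The weights 1 + |t| and 1 + |1 - t| absorb affine coefficients that may lie outside [0, 1]. *)
have [a Aa ax] := clx (e / (2 * (1 + `|t|))) (divr_gt0 e0 (w0 t)).
have [b Ab by_] := cly (e / (2 * (1 + `|1 - t|))) (divr_gt0 e0 (w0 (1 - t))).
exists (t *: a + (1 - t) *: b); first exact: aA.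
rewrite opprD addrACA -!scalerBr; apply: le_lt_trans (ler_normD _ _) _.
rewrite !normrZ [e](splitr); apply: ltrD.
- apply: (@le_lt_trans _ _ ((1 + `|t|) * `|a - x|)); first by rewrite ler_wpM2r// lerDr.
  by rewrite mulrC -ltr_pdivlMr ?ltr_pwDl// -mulrA -invfM.
- apply: (@le_lt_trans _ _ ((1 + `|1 - t|) * `|b - y|)); first by rewrite ler_wpM2r// lerDr.
  by rewrite mulrC -ltr_pdivlMr ?ltr_pwDl// -mulrA -invfM.
Qed.

Lemma affine_hull_affine A : is_affine (affine_hull A).
Proof. by move=> x y t Ax Ay B hB; apply: hB.1; [exact: Ax|exact: Ay]. Qed.

(** The point a + s u is an affine combination of a + u and a, and a + s u + v is 2 m - a with m the
    midpoint of a + s u and a + v. *)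
Lemma affine_subspace A a : is_affine A -> A a -> subspace [set z | A (a + z)].
Proof.
move=> aA Aa; split=> /= [|s u v Au Av]; first by rewrite addr0.
have h1 : A (a + s *: u).
  have := aA (a + u) a s Au Aa.
  by rewrite scalerDr addrAC -scalerDl subrKC scale1r.
have := aA _ _ 2 (aA _ _ 2^-1 h1 Av) Aa.
rewrite (_ : 2 *: _ + _ = a + (s *: u + v))//.
have -> : (1 - 2^-1 : R) = 2^-1 by lra.
have -> : (1 - 2 : R) = -1 by lra.
rewrite -scalerDr scalerA divff// scale1r scaleN1r.
by rewrite -addrA [a + v]addrC addrK addrA.
Qed.

(** Y is the closed affine hull of the inner convex set C translated by - c0, with c0 in [ri C]; the
    neighbourhood given by [ri] supplies the radius. *)
Lemma nearly_convex_frame D : nearly_convex D ->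
  exists Y C c0, convex_frame Y C D c0.
Proof.
move=> [C [/convex_setP cC [c0 [Cc0 nc0]] CD DC]].
pose A := closure (affine_hull C).
have CA : C `<=` A.
  by move=> c Cc; apply: subset_closure => B [_]; exact.
have aA : is_affine A by apply: closure_affine; exact: affine_hull_affine.
exists [set z | A (c0 + z)], C, c0; split=> //.
- apply: closed_comp (@closed_closure _ _) => z _.
  by apply: cvgD; [exact: cvg_cst|exact: cvg_id].
- by apply: affine_subspace => //; exact: CA.
- split.
    have /nbhs_ballP[e e0 eC] := nc0; exists e => // z Az ze.
    apply: eC => //; rewrite -ball_normE /=.
    by rewrite opprD addNKr normrN.
  by move=> c Cc /=; rewrite subrKC; exact: CA.
Qed.

Section Frame.
Variables (Y C D : set X) (c0 : X).
Hypothesis frame : convex_frame Y C D c0.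

Let cY : closed Y. Proof. by case: frame. Qed.
Let sY : subspace Y. Proof. by case: frame. Qed.
Let cC (t : R) x y : 0 <= t -> t <= 1 -> C x -> C y -> C (t *: x + (1 - t) *: y).
Proof. by case: frame => _ _ + _ _; exact. Qed.
Let CD : C `<=` D. Proof. by case: frame => _ _ _ []. Qed.
Let DC : D `<=` closure C. Proof. by case: frame => _ _ _ []. Qed.
Let c0C : rel_interior Y C c0. Proof. by case: frame => _ _ _ _ []. Qed.
Let CY c : C c -> Y (c - c0). Proof. by case: frame => _ _ _ _ [_]; exact. Qed.

Let YD u v : Y u -> Y v -> Y (u + v).
Proof. by move=> Yu Yv; rewrite -[u]scale1r; exact: sY.2. Qed.
Let YZ a u : Y u -> Y (a *: u).
Proof. by move=> Yu; rewrite -[_ *: _]addr0; apply: sY.2 => //; exact: sY.1. Qed.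
Let YB u v : Y u -> Y v -> Y (u - v).
Proof. by move=> Yu Yv; rewrite addrC -scaleN1r; exact: sY.2. Qed.

Lemma closure_frame : closure D = closure C.
Proof.
apply/seteqP; split; last exact: closureS.
by move=> x /(closureS DC); exact: closed_closure.
Qed.

Lemma frame_direction x : closure D x -> Y (x - c0).
Proof.
rewrite closure_frame => /closure_normP clx; apply: cY; apply/closure_normP => e e0.
by have [c Cc cx] := clx e e0; exists (c - c0); [exact: CY|rewrite opprB addrA subrK].
Qed.

Lemma frame_directionB x y : closure D x -> closure D y -> Y (x - y).
Proof.
move=> Dx Dy; rewrite -[x](subrK c0) -addrA -[c0 - y]opprB.
by apply: YB; exact: frame_direction.
Qed.

Lemma rel_interior_self S e : rel_interior Y S e -> S e.
Proof. by move=> [r r0 er]; rewrite -[e]addr0; apply: er; [exact: sY.1|rewrite normr0]. Qed.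

Lemma frame_center : closure D c0.
Proof. by apply: subset_closure; apply: CD; exact: rel_interior_self. Qed.

(** A point x' of C approximates x within t r / 2; the error is moved to the endpoint e, where the
    ball of radius r absorbs it after division by t. *)
Lemma rel_interior_segment x e (t : R) : closure D x -> rel_interior Y C e ->
  0 < t -> t <= 1 -> rel_interior Y C (t *: e + (1 - t) *: x).
Proof.
move=> Dx [r r0 er] t0 t1.
have tr : 0 < t * r / 2 by rewrite divr_gt0 ?mulr_gt0.
have := Dx; rewrite closure_frame => /closure_normP/(_ _ tr)[x' Cx' xx'].
exists (t * r / 2) => // z Yz zr.
have Dx' : closure D x' by apply: subset_closure; exact: CD.
have -> : t *: e + (1 - t) *: x + z =
    t *: (e + t^-1 *: (z + (1 - t) *: (x - x'))) + (1 - t) *: x'.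
  rewrite scalerDr scalerA divff ?gt_eqF// scale1r -!addrA; congr (_ + _).
  by rewrite -scalerDr subrK addrC.
apply: cC => //; first exact: ltW.
apply: er; first by apply/YZ/YD => //; apply/YZ; exact: frame_directionB.
rewrite normrZ gtr0_norm ?invr_gt0// ltr_pdivrMl//.
apply: le_lt_trans (ler_normD _ _) _.
have : `|(1 - t) *: (x - x')| <= `|x' - x|.
  by rewrite normrZ ger0_norm ?subr_ge0// distrC ler_piMl//; lra.
by lra.
Qed.

(** * The tangent cone at a point of the closure *)

Variable x : X.
Hypothesis Dx : closure D x.
Let K := tangent_cone (closure D) x.

Lemma tangent_coneE v : K v <-> forall e : R, 0 < e -> exists h y,
  [/\ 0 < h, closure D y & `|h *: (y - x) - v| < e].
Proof.
split=> [/closure_normP Kv e e0|Kv].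
  by have [_ [h h0 [y Dy <-]] hyv] := Kv e e0; exists h, y.
apply/closure_normP => e e0; have [h [y [h0 Dy hyv]]] := Kv e e0.
by exists (h *: (y - x)) => //; exists h => //; exists y.
Qed.

Lemma tangent_cone_mem y h : 0 < h -> closure D y -> K (h *: (y - x)).
Proof.
by move=> h0 Dy; apply/tangent_coneE => e e0; exists h, y; rewrite subrr normr0.
Qed.

Lemma tangent_cone_direction v : K v -> Y v.
Proof.
move=> /closure_normP Kv; apply: cY; apply/closure_normP => e e0.
have [_ [h h0 [y Dy <-]] hyv] := Kv e e0; exists (h *: (y - x)) => //.
by apply: YZ; exact: frame_directionB.
Qed.

Lemma closure_frame_convex (t : R) u v : 0 <= t -> t <= 1 ->
  closure D u -> closure D v -> closure D (t *: u + (1 - t) *: v).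
Proof.
rewrite closure_frame => t0 t1 /closure_normP Du /closure_normP Dv.
apply/closure_normP => e e0.
have [a Ca au] := Du e e0; have [b Cb bv] := Dv e e0.
exists (t *: a + (1 - t) *: b); first exact: cC.
rewrite opprD addrACA -!scalerBr; apply: le_lt_trans (ler_normD _ _) _.
rewrite !normrZ ger0_norm// ger0_norm ?subr_ge0//.
have [->|tn0] := eqVneq t 0; first by rewrite subr0 mul0r mul1r add0r.
have : t * `|a - u| < t * e by rewrite ltr_pM2l// lt_neqAle eq_sym tn0.
have : (1 - t) * `|b - v| <= (1 - t) * e by rewrite ler_wpM2l ?subr_ge0// ltW.
by lra.
Qed.

(** For sums, h (y - x) + k (z - x) is h + k times m - x, with m a weighted mean of y and z. *)
Lemma tangent_cone_convex_cone : convex_cone K.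
Proof.
split.
- by have := tangent_cone_mem ltr01 Dx; rewrite subrr scaler0.
- move=> u v /tangent_coneE Ku /tangent_coneE Kv; apply/tangent_coneE => e e0.
  have [|h [y [h0 Dy hy]]] := Ku (e / 2); first by lra.
  have [|k [z [k0 Dz kz]]] := Kv (e / 2); first by lra.
  have hk0 : 0 < h + k by rewrite addr_gt0.
  pose t := h / (h + k).
  exists (h + k), (t *: y + (1 - t) *: z); split=> //.
    by apply: closure_frame_convex => //; rewrite ?divr_ge0 ?ler_pdivrMr ?mul1r ?lerDl// ltW.
  have -> : (h + k) *: (t *: y + (1 - t) *: z - x) = h *: (y - x) + k *: (z - x).
    have e1 : (h + k) * t = h by rewrite /t mulrC divfK// gt_eqF.
    have e2 : (h + k) * (1 - t) = k by rewrite mulrBr e1 mulr1; lra.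
    rewrite scalerBr scalerDr !scalerA e1 e2 !scalerBr scalerDl opprD.
    by rewrite addrACA.
  rewrite opprD addrACA; apply: le_lt_trans (ler_normD _ _) _.
  by rewrite [e]splitr; exact: ltrD.
- move=> t u t0 /tangent_coneE Ku; apply/tangent_coneE => e e0.
  have [|h [y [h0 Dy hy]]] := Ku (e / t); first exact: divr_gt0.
  exists (t * h), y; split=> //; first exact: mulr_gt0.
  by rewrite -scalerA -scalerBr normrZ gtr0_norm// mulrC -ltr_pdivlMr.
Qed.

Lemma tangent_cone_closed : closed K.
Proof. exact: closed_closure. Qed.

(** K lies in the closed subspace Y, so its closed affine hull does too, and a ball of Y around v is
    enough. *)
Lemma rel_interior_ri v : rel_interior Y K v -> ri K v.
Proof.
move=> vK; split; first exact: rel_interior_self.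
have Yv : Y v by apply: tangent_cone_direction; exact: rel_interior_self.
have [r r0 rK] := vK; apply/nbhs_ballP; exists r => //= w.
rewrite -ball_normE /= distrC => vw Aw.
rewrite -[w](subrK v) addrC; apply: rK => //.
apply: YB => //; apply: cY; move: w Aw {vw}; apply: closureS => w.
apply; split; last by move=> u; exact: tangent_cone_direction.
by move=> u u' t Yu Yu'; apply: YD; exact: YZ.
Qed.

Lemma rel_interior_center : rel_interior Y K (c0 - x).
Proof.
have [r r0 rC] := c0C; exists r => // z Yz zr.
have := @tangent_cone_mem (c0 + z) 1 ltr01; rewrite scale1r addrAC; apply.
by apply: subset_closure; apply: CD; exact: rC.
Qed.

Lemma rel_interior_cone_segment v e (t : R) : K v -> rel_interior Y K e ->
  0 < t -> t <= 1 -> rel_interior Y K (t *: e + (1 - t) *: v).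
Proof.
have [K0 KD KZ] := tangent_cone_convex_cone.
move=> Kv [r r0 eK] t0 t1; exists (t * r); first exact: mulr_gt0.
move=> z Yz zr; rewrite addrAC; apply: KD.
  have -> : t *: e + z = t *: (e + t^-1 *: z).
    by rewrite scalerDr scalerA divff ?gt_eqF// scale1r.
  apply: KZ => //; apply: eK; first exact: YZ.
  by rewrite normrZ gtr0_norm ?invr_gt0// ltr_pdivrMl.
have [->|t1'] := eqVneq t 1; first by rewrite subrr scale0r.
by apply: KZ => //; rewrite subr_gt0 lt_neqAle t1'.
Qed.

(* v is a convex combination of c0 - x and of a vector of K slightly beyond v. *)
Lemma ri_tangent_cone v : ri K v -> exists2 h, 0 < h & rel_interior Y C (x + h *: v).
Proof.
move=> [Kv /nbhs_ballP[d d0 dK]]; pose u := c0 - x.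
have Ku : K u by exact: rel_interior_self rel_interior_center.
have [r r0 rC] := c0C.
(* This length keeps v + eps (v - u) within d of v; lying in the affine hull as well, it belongs to
   K. *)
pose eps := d / (2 * (1 + `|v - u|)).
have w0 : 0 < 2 * (1 + `|v - u|) by rewrite mulr_gt0// ltr_pwDl.
have eps0 : 0 < eps by rewrite divr_gt0.
have Kw : K (v + eps *: (v - u)).
  apply: dK.
    rewrite -ball_normE /= opprD addNKr normrN normrZ gtr0_norm//.
    rewrite /eps mulrAC ltr_pdivrMr// ltr_pM2l//.
    by have := normr_ge0 (v - u); lra.
  apply: subset_closure => B [aB KB].
  have := aB v u (1 + eps) (KB _ Kv) (KB _ Ku).
  have -> : 1 - (1 + eps) = - eps by ring.
  by rewrite scalerDl scale1r scaleNr -addrA -scalerBr.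
have /tangent_coneE := Kw.
move=> /(_ (eps * r / 2)); rewrite divr_gt0 ?mulr_gt0// => /(_ isT)[k [y [k0 Dy kyw]]].
pose w := k *: (y - x) - (v + eps *: (v - u)).
have Yw : Y w.
  apply: YB; first by apply: YZ; exact: frame_directionB.
  exact: tangent_cone_direction.
have ke0 : 0 < k + eps by rewrite addr_gt0.
have e10 : 0 < 1 + eps by rewrite addr_gt0.
pose t := eps / (k + eps).
have t0 : 0 < t by rewrite divr_gt0.
have t1 : t <= 1 by rewrite ler_pdivrMr// mul1r lerDr ltW.
(* Since k (y - x) = v + eps (v - u) + w, the shift by w / eps cancels the error w and (k + eps) (e'
   - x) = (1 + eps) v. The bound |w| < eps r / 2 keeps the shifted c0 in the relative interior of
   C. *)
pose e' := t *: (c0 - eps^-1 *: w) + (1 - t) *: y.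
exists ((1 + eps) / (k + eps)); first by rewrite divr_gt0.
have -> : x + ((1 + eps) / (k + eps)) *: v = e'.
  apply: (scalerI (lt0r_neq0 ke0)); rewrite scalerDr scalerA mulrCA divff ?gt_eqF// mulr1.
  have e1 : (k + eps) * t = eps by rewrite /t mulrC divfK// gt_eqF.
  have e2 : (k + eps) * (1 - t) = k by rewrite mulrBr e1 mulr1; lra.
  rewrite /e' scalerDr !scalerA e1 e2 scalerBr scalerA divff ?gt_eqF// scale1r.
  rewrite /w /u opprB -(addrA (eps *: c0)) -(addrA (v + _)).
  have -> : - (k *: (y - x)) + k *: y = k *: x by rewrite addrC -scalerBr subKr.
  have -> : eps *: (v - (c0 - x)) = eps *: (v + x) - eps *: c0.
    by rewrite opprB addrA scalerBr.
  rewrite [RHS]addrC !addrA [in RHS]addrAC subrK !scalerDl scalerDr scale1r.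
  by rewrite -[LHS]addrA [RHS]addrC; congr (_ + _); rewrite addrC addrA.
apply: rel_interior_segment => //.
exists (r / 2); first by lra.
move=> z Yz zr; rewrite -addrA; apply: rC.
  by rewrite addrC; apply: YB => //; exact: YZ.
apply: le_lt_trans (ler_normD _ _) _.
rewrite normrN normrZ gtr0_norm ?invr_gt0//.
have : eps^-1 * `|w| < r / 2 by rewrite ltr_pdivrMl// mulrA.
by lra.
Qed.

End Frame.
End NearlyConvex.

(** * Extension and separation of functionals *)

Section DualExtension.
Context {R : realType} {X : completeNormedModType R}.
Implicit Types (xs ys zs : dual X) (Y : set X) (A : set (dual X)).

(** The pairs (- u, ys u) with u in Y impose zs <= ys on Y; equality follows by symmetry of Y, and
    the gauge M |u| gives the bound. *)
Lemma dual_extension Y (M : R) ys : subspace Y -> 0 <= M -> bounded_on Y M ys ->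
  exists2 zs, dual_bounded M zs & forall u, Y u -> zs u = ys u.
Proof.
move=> [Y0 YZ] M0 ysM.
have YN u : Y u -> Y (- u).
  by move=> Yu; rewrite -scaleN1r -[_ *: _]addr0; exact: YZ.
pose S := [set a : X * R | exists2 u, Y u & a = (- u, ys u : R)].
have [|||f [lf fM fS]] := @hahn_banach_cone _ _ (fun u : X => M * `|u|) S.
- split=> [u v|t u t0]; first by rewrite -mulrDr ler_wpM2l// ler_normD.
  by rewrite normrZ gtr0_norm// mulrCA.
- split.
  + by exists 0 => //; rewrite oppr0 linear0.
  + move=> _ _ [u Yu ->] [v Yv ->] /=; exists (u + v).
      by rewrite -[u]scale1r; exact: YZ.
    by rewrite opprD linearD.
  + move=> t _ t0 [u Yu ->] /=; exists (t *: u).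
      by rewrite -[_ *: _]addr0; exact: YZ.
    by rewrite scalerN [ys (t *: u)]linearZ.
- move=> _ [u Yu ->] /=; rewrite normrN.
  by have := ysM u Yu; rewrite ler_norml => /andP[+ _]; lra.
have [zs zsE zsM] := dual_of_bounded lf fM.
exists zs => // u Yu.
have := fS (- u, ys u) (ex_intro2 _ _ u Yu erefl).
have := fS (u, ys (- u)); rewrite -{1}[u]opprK => /(_ (ex_intro2 _ _ (- u) (YN u Yu) erefl)).
by rewrite /= -!zsE !linearN /=; lra.
Qed.

(** These sets generate a filter that converges to xs pointwise, hence weak-star. The sum matches
    the sublinear gauge of [dual_separation]. *)
Lemma dual_nbhs_basis xs A : nbhs xs A -> exists (us : seq X) (e : R),
  0 < e /\ forall ys, \sum_(u <- us) `|ys u - xs u| < e -> A ys.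
Proof.
pose W (p : seq X * R) : set (dual X) :=
  [set ys | \sum_(u <- p.1) `|ys u - xs u| < p.2].
pose F := filter_from [set p : seq X * R | 0 < p.2] W.
have FF : Filter F.
  apply: filter_from_filter; first by exists ([::], 1); exact: ltr01.
  move=> [us e] [vs d] /= e0 d0; exists (us ++ vs, Num.min e d) => /=.
    by rewrite lt_min e0.
  move=> ys; rewrite /W /= big_cat /= lt_min => /andP[h1 h2].
  have s1 : 0 <= \sum_(u <- us) `|ys u - xs u| by apply: sumr_ge0.
  have s2 : 0 <= \sum_(u <- vs) `|ys u - xs u| by apply: sumr_ge0.
  by split; [apply: le_lt_trans h1|apply: le_lt_trans h2]; rewrite ?lerDl ?lerDr.
have Fxs : F --> xs.
  apply/dual_cvgP => u; apply/cvgrPdist_lt => e e0.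
  exists ([:: u], e) => // ys; rewrite /W /= big_seq1 distrC; exact.
by move=> /Fxs [[us e] /= e0 HA]; exists us, e; split=> // ys /HA.
Qed.

(* Hahn-Banach is applied in R^n, on the values at the n points that define a
   weak-star neighbourhood of xs disjoint from A. *)
Lemma dual_separation A xs : closed A -> convex_set A -> ~ A xs ->
  exists v (e : R), 0 < e /\ forall ys, A ys -> ys v <= xs v - e.
Proof.
move=> cA /convex_setP kA nAxs.
have /dual_nbhs_basis[us [e [e0 Hus]]] : nbhs xs (~` A).
  by apply: open_nbhs_nbhs; split=> //; exact: closed_openC.
have eA ys : A ys -> e <= \sum_(u <- us) `|ys u - xs u|.
  by move=> Ays; rewrite leNgt; apply/negP => /Hus.
have [->|/set0P[a0 Aa0]] := eqVneq A set0; first by exists 0, 1; split.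
pose n := size us.
pose ev (ys : dual X) : 'rV[R]_n := \row_i ys us`_i.
pose p (w : 'rV[R]_n) : R := \sum_i `|w 0 i|.
pose S := [set a : 'rV[R]_n * R | exists t ys, [/\ 0 <= t, A ys &
  a = (t *: ev (ys - xs), - (t * e))]].
have [|||f [lf fp fS]] := @hahn_banach_cone _ _ p S.
- split=> [w z|t w t0]; rewrite /p.
    by rewrite -big_split /=; apply: ler_sum => i _; rewrite mxE ler_normD.
  rewrite mulr_sumr; apply: ler_sum => i _.
  by rewrite mxE normrM gtr0_norm.
- split.
  + by exists 0, a0; rewrite scale0r mul0r oppr0.
  + move=> _ _ [t [ys [t0 Ay ->]]] [s [zs [s0 Az ->]]] /=.
    have [/eqP|ts] := eqVneq (t + s) 0.
      rewrite paddr_eq0// => /andP[/eqP -> /eqP ->].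
      by exists 0, a0; rewrite !scale0r !mul0r oppr0 !addr0.
    have ts0 : 0 < t + s by rewrite lt0r ts addr_ge0.
    exists (t + s), (t / (t + s) *: ys + (1 - t / (t + s)) *: zs); split.
    * exact: ltW.
    * by apply: kA => //; rewrite ?divr_ge0 ?ler_pdivrMr ?mul1r ?lerDl// ltW.
    * rewrite mulrDl opprD; congr (_, _); apply/rowP => i; rewrite !mxE.
      rewrite -[(_ - xs) _ in RHS]/
        (t / (t + s) * ys us`_i + (1 - t / (t + s)) * zs us`_i - xs us`_i).
      rewrite -[(ys - xs) _]/(ys us`_i - xs us`_i) -[(zs - xs) _]/(zs us`_i - xs us`_i).
      by field.
  + move=> s _ s0 [t [ys [t0 Ay ->]]] /=; exists (s * t), ys; split=> //.
      by rewrite mulr_ge0// ltW.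
    by rewrite scalerA mulrN mulrA.
- move=> _ [t [ys [t0 Ay ->]]] /=; rewrite subr_ge0 /p.
  have -> : \sum_i `|(t *: ev (ys - xs)) 0 i| = t * \sum_(u <- us) `|ys u - xs u|.
    rewrite (big_nth 0) big_mkord mulr_sumr; apply: eq_bigr => i _.
    by rewrite !mxE normrM ger0_norm.
  by rewrite ler_wpM2l// eA.
pose g : {linear 'rV[R]_n -> R^o} := HB.pack (f : 'rV[R]_n -> R^o)
  (GRing.isLinear.Build _ _ _ _ _ lf).
(* The vector v represents g: evaluation at the points [us] followed by g is evaluation at v. *)
pose v := \sum_(i < n) g (delta_mx 0 i) *: us`_i.
have gv ys : g (ev ys) = ys v.
  rewrite [ev ys]row_sum_delta /v !linear_sum; apply: eq_bigr => i _.
  by rewrite !linearZ mxE; exact: mulrC.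
exists (- v), e; split=> // ys Ay.
have := fS (1 *: ev (ys - xs), - (1 * e)).
rewrite /= scale1r mul1r => /(_ _)/wrap[]; first by exists 1, ys; rewrite scale1r mul1r.
rewrite -[f _]/(g (ev (ys - xs))) gv -[(ys - xs) v]/(ys v - xs v) !linearN /=.
by lra.
Qed.

(** In xs_i(x_i) = xs_i(x_i - x0) + xs_i(x0), boundedness makes the first term vanish in the
    limit. *)
Lemma pairing_cvg (I : Type) (F : set_system I) (FF : ProperFilter F)
    (x : I -> X) (xs : I -> dual X) (x0 : X) (l : dual X) (M : R) : x @ F --> x0 -> xs @ F --> l ->
  F [set i | dual_bounded M (xs i)] -> (fun i => xs i (x i) : R) @ F --> (l x0 : R).
Proof.
move=> xx0 xsl FM.
have h1 : (fun i => xs i x0 : R) @ F --> (l x0 : R).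
  have /dual_cvgP := xsl; exact.
have h2 : (fun i => xs i (x i - x0) : R) @ F --> (0 : R).
  apply/cvgr0Pnorm_lt => e e0.
  have M0 : 0 < 1 + `|M| by rewrite ltr_pwDl.
  have /cvgrPdist_lt/(_ (e / (1 + `|M|)) (divr_gt0 e0 M0)) xe := xx0.
  near=> i; have bM : dual_bounded M (xs i) by near: i.
  apply: le_lt_trans (bM _) _.
  apply: (@le_lt_trans _ _ ((1 + `|M|) * `|x i - x0|)).
    by rewrite ler_wpM2r//; have := ler_norm M; lra.
  by rewrite mulrC -ltr_pdivlMr// distrC; near: i.
rewrite -[l x0 : R]add0r (_ : (fun i => _) = (fun i => (xs i (x i - x0) : R) + xs i x0)).
  exact: cvgD.
by apply/funext => i; rewrite linearB /= subrK.
Unshelve. all: by end_near. Qed.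

End DualExtension.

(** * Consequences of maximality and of representability *)

Section MaximalMonotone.
Context {R : realType} {X : completeNormedModType R}.
Implicit Types (T : X -> set (dual X)) (x y a : X) (xs ys az l n : dual X).

Lemma dualBE xs ys x : (xs - ys) x = xs x - ys x :> R.
Proof. by []. Qed.

Lemma dualDE xs ys x : (xs + ys) x = xs x + ys x :> R.
Proof. by []. Qed.

Lemma dualZE (t : R) xs x : (t *: xs) x = t * xs x :> R.
Proof. by []. Qed.

(** Adjoining one monotonically related pair keeps the graph monotone, so a maximal T already
    contains it. *)
Lemma maximal_monotoneP T : maximal_monotone T <-> monotone_op T /\
  forall x xs, (forall a az, T a az -> 0 <= (xs - az) (x - a)) -> T x xs.
Proof.
split=> [[mT maxT]|[mT relT]]; split=> //.
  move=> x xs xT.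
  pose S a : set (dual X) := [set az | T a az \/ (a = x /\ az = xs)].
  have mS : monotone_op S.
    move=> a b az bs [Ta|[-> ->]] [Tb|[-> ->]].
    - exact: mT.
    - have := xT a az Ta; rewrite !dualBE !linearB /=; lra.
    - exact: xT.
    - by rewrite dualBE subrr.
  have TS : graph T `<=` graph S by move=> z; left.
  have : graph S (x, xs) by right.
  by rewrite (maxT S mS TS).
move=> S mS TS; apply/seteqP; split=> // -[x xs] Sx.
by apply: relT => a az Ta; apply: mS => //; exact: (TS (a, az)).
Qed.

(** A normal vector n at x satisfies n(x - a) >= 0 for a in the domain, so adding it preserves
    relatedness to T. *)
Lemma op_add_normal_cone T : maximal_monotone T ->
  T = op_add T (normal_cone (dom T)).
Proof.
move=> /maximal_monotoneP[mT relT]; apply/funext => x; apply/seteqP; split.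
  move=> xs Tx; exists xs => //; exists 0; last by rewrite addr0.
  by split=> [|y _]; [exists xs|].
move=> _ [xs Tx [n [_ nx] <-]]; apply: relT => a az Ta.
have := mT _ _ _ _ Tx Ta; have := nx a (ex_intro _ _ Ta).
by rewrite !dualBE dualDE !linearB /=; lra.
Qed.

Lemma net_filter_proper (I : Type) (le : I -> I -> Prop) :
  directed le -> ProperFilter (net_filter le).
Proof.
move=> [[i0] le_refl le_trans le_dir]; apply: filter_from_proper; last first.
  by move=> i _; exists i => /=.
apply: filter_from_filter; first by exists i0.
move=> i j _ _; have [k [ik jk]] := le_dir i j; exists k => // l /= kl.
by split; [exact: le_trans ik kl|exact: le_trans jk kl].
Qed.

(** The inequalities expressing relatedness to T are affine in xs and, by [pairing_cvg], survive
    limits of bounded nets. *)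
Lemma maximal_monotone_D T : maximal_monotone T -> condition_D T.
Proof.
move=> /maximal_monotoneP[mT relT]; split.
  move=> x; apply/convex_setP => t xs ys t0 t1 Tx Ty; apply: relT => a az Ta.
  have h1 := mT _ _ _ _ Tx Ta; have h2 := mT _ _ _ _ Ty Ta.
  rewrite dualBE dualDE !dualZE; rewrite !dualBE in h1 h2.
  have : 0 <= t * (xs (x - a) - az (x - a)) by rewrite mulr_ge0.
  have : 0 <= (1 - t) * (ys (x - a) - az (x - a)) by rewrite mulr_ge0// subr_ge0.
  by lra.
move=> I le x xs x0 l dle Txs xx0 xsl [M xsM]; apply: relT => a az Ta.
have := net_filter_proper dle.
move: (net_filter le) xx0 xsl => F xx0 xsl FF.
have xa : (fun i => x i - a) @ F --> x0 - a.
  by apply: cvgB => //; exact: cvg_cst.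
have h1 : (fun i => xs i (x i - a) : R) @ F --> (l (x0 - a) : R).
  apply: (@pairing_cvg _ _ _ _ FF _ _ _ _ M xa xsl).
  by apply: nearW => i; exact: dual_bounded_norm.
have h2 : (fun i => az (x i - a) : R) @ F --> (az (x0 - a) : R).
  exact: (cvg_comp _ _ xa (@dual_continuous _ _ az _)).
rewrite dualBE.
apply: (cvgr_to_ge (cvgB h1 h2)); apply: nearW => i /=.
by have := mT _ _ _ _ (Txs i) Ta.
Qed.

Definition fitzpatrick T (z : X * dual X) : \bar R :=
  ereal_sup [set (w.2 z.1 + z.2 w.1 - w.2 w.1)%:E | w in graph T].

(** By monotonicity the Fitzpatrick function equals the pairing on T. A value at most the pairing
    means relatedness to T, hence membership, so the pairing is dominated everywhere. Convexity and
    lower semicontinuity come from its being a supremum of continuous affine functions. *)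
Lemma maximal_monotone_R T : graph T !=set0 -> maximal_monotone T -> condition_R T.
Proof.
move=> [[b bs] Tb] /maximal_monotoneP[mT relT].
have ge (z w : X * dual X) : graph T w -> ((w.2 z.1 + z.2 w.1 - w.2 w.1)%:E <= fitzpatrick T z)%E.
  by move=> Tw; apply: ereal_sup_ubound; exists w.
have eqT z : graph T z -> fitzpatrick T z = (z.2 z.1)%:E.
  move=> Tz; apply/eqP; rewrite eq_le; apply/andP; split.
    apply: ge_ereal_sup => _ [[a az] Ta <-]; rewrite lee_fin /=.
    by have := mT z.1 a z.2 az Tz Ta; rewrite dualBE !linearB /=; lra.
  by have := ge z z Tz; rewrite addrK.
have relF x xs : (fitzpatrick T (x, xs) <= (xs x)%:E)%E -> T x xs.
  move=> fx; apply: relT => a az Ta.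
  rewrite dualBE !linearB /=.
  by have := le_trans (ge (x, xs) (a, az) Ta) fx; rewrite lee_fin /=; lra.
exists (fitzpatrick T); split.
- split=> [z|]; last by exists (b, bs); rewrite eqT.
  by rewrite -ltNye; apply: lt_le_trans (ge z _ Tb); exact: ltNyr.
- move=> z w t t0 t1; apply: ge_ereal_sup => _ [[a az] Ta <-].
  rewrite -[X in (X <= _)%E]/
    (az (t *: z + (1 - t) *: w).1 + (t *: z + (1 - t) *: w).2 a - az a)%:E.
  have t1' : 0 < 1 - t by rewrite subr_gt0.
  apply: (@le_trans _ _ (t%:E * (az z.1 + z.2 a - az a)%:E +
      (1 - t)%:E * (az w.1 + w.2 a - az a)%:E)%E).
    rewrite -!EFinM -EFinD lee_fin.
    have -> : az (t *: z + (1 - t) *: w).1 = t * az z.1 + (1 - t) * az w.1 :> R.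
      by rewrite [LHS](linearD az (t *: z.1) ((1 - t) *: w.1)) !linearZ.
    have -> : (t *: z + (1 - t) *: w).2 a = t * z.2 a + (1 - t) * w.2 a :> R by [].
    by lra.
  by apply: leeD; rewrite lee_pmul2l// ?fin_numE//; exact: ge _ (a, az) Ta.
- move=> z r /ereal_sup_gt[_ [[a az] Ta <-]]; rewrite lte_fin /= => rz.
  exists [set y : X * dual X | r < az y.1 + y.2 a - az a]; last first.
    by move=> y /= ry; apply: lt_le_trans (ge y _ Ta); rewrite lte_fin.
  have : (fun y : X * dual X => az y.1 + y.2 a - az a : R) @ z --> az z.1 + z.2 a - az a.
    apply: cvgB; last exact: cvg_cst.
    apply: cvgD.
      apply: (@continuous_comp _ _ _ fst az); first exact: cvg_fst.
      exact: dual_continuous.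
    apply: (@continuous_comp _ _ _ snd (fun ys : dual X => ys a : R)).
      exact: cvg_snd.
    exact: dual_eval_continuous.
  by move=> /cvgr_gt; exact.
- move=> x xs; have [|/ltW//] := leP (fitzpatrick T (x, xs)) (xs x)%:E.
  by move=> /relF Tx; rewrite (eqT (x, xs)).
- apply/seteqP; split=> -[x xs] /=; first exact: eqT.
  by move=> h; apply: relF; rewrite h.
Qed.

(** For fixed x the pairing is affine in xs, so convexity of f gives convex values. Along a bounded
    net in T the values of f are pairings converging to l(x0), and lower semicontinuity gives f (x0,
    l) <= l(x0). *)
Lemma representable_D T : condition_R T -> condition_D T.
Proof.
move=> [f [fp fc fl fge fT]].
have TP x xs : T x xs <-> f (x, xs) = (xs x)%:E.
  by rewrite -[T x xs]/(graph T (x, xs)) fT.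
have TP' x xs : (f (x, xs) <= (xs x)%:E)%E -> T x xs.
  by move=> h; apply/TP/eqP; rewrite eq_le h fge.
split.
  move=> x; apply/convex_setP => t xs ys.
  rewrite le_eqVlt => /predU1P[<-|t0]; first by rewrite scale0r add0r subr0 scale1r.
  rewrite le_eqVlt => /predU1P[->|t1]; first by rewrite subrr scale0r addr0 scale1r.
  move=> /TP fx /TP fy; apply: TP'.
  have := fc (x, xs) (x, ys) t t0 t1; rewrite fx fy -!EFinM -EFinD.
  suff -> : t *: (x, xs) + (1 - t) *: (x, ys) = (x, t *: xs + (1 - t) *: ys) by [].
  by congr (_, _); rewrite /= -scalerDl subrKC scale1r.
move=> I le x xs x0 l dle Txs xx0 xsl [M xsM]; apply: TP'.
rewrite leNgt; apply/negP => lf.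
have := net_filter_proper dle.
move: (net_filter le) xx0 xsl => F xx0 xsl FF.
have [r /andP[lr rf]] : exists r : R, (l x0 < r) && (r%:E < f (x0, l))%E.
  case: (f (x0, l)) lf => [c| |]//=.
    rewrite lte_fin => lc; exists ((l x0 + c) / 2).
    by rewrite lte_fin; apply/andP; split; lra.
  by move=> _; exists (l x0 + 1); rewrite ltry andbT; lra.
have [V [[A B] /= [Ax0 Bl] ABV] Vf] := fl _ _ rf.
have h2 : (fun i => xs i (x i) : R) @ F --> (l x0 : R).
  apply: (@pairing_cvg _ _ _ _ FF _ _ _ _ M xx0 xsl).
  by apply: nearW => i; exact: dual_bounded_norm.
have FA : F (x @^-1` A) by exact: xx0.
have FB : F (xs @^-1` B) by exact: xsl.
have Fr : F [set i | xs i (x i) < r] by have /cvgr_lt/(_ _ lr) := h2.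
have [i [[/= Axi Bxsi] xir]] := filter_ex (filterI (filterI FA FB) Fr).
have := Vf _ (ABV (x i, xs i) (conj Axi Bxsi)); rewrite (TP _ _).1// lte_fin => rxi.
by have := lt_trans rxi xir; rewrite ltxx.
Qed.

End MaximalMonotone.

(** * From demiclosedness to condition (H) *)

Section ConditionH.
Context {R : realType} {X : completeNormedModType R}.
Variables (T : X -> set (dual X)) (Y C : set X) (c0 : X).
Hypothesis mT : monotone_op T.
Hypothesis frame : convex_frame Y C (dom T) c0.
Hypothesis TN : T = op_add T (normal_cone (dom T)).
Implicit Types (x v : X) (xs ys zs n : dual X).

Let cY : closed Y. Proof. by case: frame. Qed.
Let sY : subspace Y. Proof. by case: frame. Qed.
Let CT : C `<=` dom T. Proof. by case: frame => _ _ _ []. Qed.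
Let YZ (a : R) u : Y u -> Y (a *: u).
Proof. by move=> Yu; rewrite -[_ *: _]addr0; apply: sY.2 => //; exact: sY.1. Qed.
Let YD u v : Y u -> Y v -> Y (u + v).
Proof. by move=> Yu Yv; rewrite -[u]scale1r; exact: sY.2. Qed.
Let clT x : dom T x -> closure (dom T) x. Proof. exact: subset_closure. Qed.

Lemma normal_add x xs n : T x xs -> normal_cone (dom T) x n -> T x (xs + n).
Proof. by move=> Tx Nn; rewrite TN; exists xs => //; exists n. Qed.

Lemma normal_cone_scale x n (t : R) : 0 <= t -> normal_cone (dom T) x n ->
  normal_cone (dom T) x (t *: n).
Proof.
move=> t0 [Dx nx]; split=> // y Dy.
by rewrite dualZE mulr_ge0_le0// nx.
Qed.

(* Elements of T x may be changed off Y, since the annihilator of Y lies in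
   the normal cone. *)
Lemma change_off_direction x xs ys : T x xs -> (forall u, Y u -> ys u = xs u) -> T x ys.
Proof.
move=> Tx ysE; rewrite -[ys](subrK xs) addrC; apply: normal_add => //.
have Dx : dom T x by exists xs.
split=> // y Dy; rewrite dualBE ysE ?subrr//.
by apply: (frame_directionB frame); exact: clT.
Qed.

(** With e = x + h0 v and small z in Y, monotonicity against T at e + z bounds ys(z) + (h0 - h)
    ys(v), by local boundedness at e. The lower bound alpha on ys(v) then bounds ys(z), uniformly in
    h. *)
Lemma bounded_near_end x v (h0 alpha : R) : closure (dom T) x -> 0 < h0 -> Y v ->
  rel_interior Y C (x + h0 *: v) -> exists2 M : R, 0 < M & forall h ys,
    0 <= h -> h < h0 -> T (x + h *: v) ys -> alpha <= ys v -> bounded_on Y M ys.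
Proof.
move=> Dx h00 Yv eC; set e := x + h0 *: v in eC.
have [r r0 er] := eC.
have eT : rel_interior Y (dom T) e by exists r => // z Yz zr; apply: CT; exact: er.
have De : closure (dom T) e by apply/clT/(rel_interior_self frame eT).
have domY y : dom T y -> Y (y - e).
  by move=> Dy; apply: (frame_directionB frame) => //; exact: clT.
have [d [P [d0 P0 PT]]] := monotone_locally_bounded mT cY sY domY eT.
pose s := Num.min r d / 2.
have md0 : 0 < Num.min r d by rewrite lt_min r0.
have s0 : 0 < s by rewrite divr_gt0.
have sr : s < r.
  have : Num.min r d <= r by rewrite ge_min lexx.
  by rewrite /s; lra.
have sd : s < d.
  have : Num.min r d <= d by rewrite ge_min lexx orbT.
  by rewrite /s; lra.
(* The first term bounds p at e + z - (x + h v); the second compensates (h0 - h) ys(v) when alpha is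
   negative. *)
pose B := P * (s + h0 * `|v|) + h0 * `|alpha|.
have B0 : 0 < B.
  by rewrite ltr_wpDr ?mulr_ge0 ?mulr_gt0 ?ltr_wpDr ?mulr_ge0// ltW.
exists (B / s) => [|h ys h_ge0 hh0 Ty ysv]; first exact: divr_gt0.
have small z : Y z -> `|z| <= s -> ys z <= B.
  move=> Yz zs; have [p Tp] := CT (er z Yz (le_lt_trans zs sr)).
  have pP : bounded_on Y P p.
    by apply: PT Tp _; rewrite addrC addKr; exact: le_lt_trans sd.
  have := mT Tp Ty; rewrite dualBE.
  have -> : e + z - (x + h *: v) = z + (h0 - h) *: v.
    by rewrite /e [x + _ + z]addrAC opprD addrACA scalerBl [x + z]addrC addrK.
  have Yw : Y (z + (h0 - h) *: v) by apply: YD => //; exact: YZ.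
  have h1 := le_trans (ler_norm _) (pP _ Yw).
  have h2 : P * `|z + (h0 - h) *: v| <= P * (s + h0 * `|v|).
    rewrite ler_pM2l// (le_trans (ler_normD _ _))// lerD// normrZ.
    by rewrite ler_wpM2r// ger0_norm; lra.
  have -> : ys (z + (h0 - h) *: v) = ys z + (h0 - h) * ys v :> R.
    by rewrite linearD linearZ.
  move=> h3.
  have h4 : - (h0 * `|alpha|) <= (h0 - h) * ys v.
    apply: (@le_trans _ _ ((h0 - h) * alpha)); last by rewrite ler_wpM2l//; lra.
    rewrite lerNl -mulrN; apply: (@le_trans _ _ ((h0 - h) * `|alpha|)).
      by rewrite ler_wpM2l ?lerNnorm//; [lra|rewrite -normrN ler_norm].
    by rewrite ler_wpM2r//; lra.
  by rewrite /B; lra.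
move=> u Yu; have [->|u0] := eqVneq u 0; first by rewrite linear0 !normr0 mulr0.
have nu0 : 0 < `|u| by rewrite normr_gt0.
have half w : Y w -> `|w| = `|u| -> ys w <= B / s * `|u|.
  move=> Yw wu; have := small ((s / `|u|) *: w) (YZ _ Yw).
  rewrite normrZ wu normrM normfV normr_id gtr0_norm// divfK ?gt_eqF// => /(_ (lexx _)).
  rewrite linearZ /= -[_ *: _]/(s / `|u| * ys w).
  by rewrite mulrAC -ler_pdivlMr ?invr_gt0// invrK -ler_pdivlMl// mulrC mulrAC.
have YNu : Y (- u) by rewrite -scaleN1r; exact: YZ.
have := half _ YNu (normrN u); have := half u Yu erefl; rewrite linearN /= => h1 h2.
by rewrite ler_norml; apply/andP; split; lra.
Qed.

(** Demiclosedness requires a bound on the full dual norm, while monotonicity controls xs only on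
    Y. *)
Lemma extend_bounded x xs (M : R) : 0 <= M -> T x xs -> bounded_on Y M xs ->
  exists zs, [/\ T x zs, dual_norm zs <= M, dual_bounded M zs
    & forall u, Y u -> zs u = xs u].
Proof.
move=> M0 Tx xsM; have [zs zsM zsE] := dual_extension sY M0 xsM.
by exists zs; split=> //; [exact: change_off_direction Tx zsE|exact: dual_norm_le].
Qed.

(** Bounded choices from T (x + h v) have a weak-star limit along an ultrafilter finer than h -> 0+;
    it lies in T x and inherits the lower bound at v. *)
Lemma demiclosed_end x v (h0 alpha : R) : demiclosed T ->
  closure (dom T) x -> 0 < h0 -> Y v -> rel_interior Y C (x + h0 *: v) ->
  (forall h ys, 0 < h -> h < h0 -> T (x + h *: v) ys -> alpha <= ys v) ->
  exists2 xs, T x xs & alpha <= xs v.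
Proof.
move=> demT Dx h00 Yv eC Talpha.
have [M M0 HM] := bounded_near_end alpha Dx h00 Yv eC.
have /choice[zs zsP] : forall h : R, exists zs, 0 < h -> h < h0 ->
    [/\ T (x + h *: v) zs, dual_norm zs <= M, dual_bounded M zs & alpha <= zs v].
  move=> h; have [h_gt0|h_le0] := ltP 0 h; last by exists 0 => h1; lra.
  have [hh0|hh0] := ltP h h0; last by exists 0 => _ h1; lra.
  have hC : C (x + h *: v).
    (* The point x + h v is (h / h0) e + (1 - h / h0) x with e = x + h0 v. *)
    have := rel_interior_segment frame Dx eC (divr_gt0 h_gt0 h00).
    rewrite ler_pdivrMr// mul1r => /(_ (ltW hh0))/(rel_interior_self frame).
    rewrite scalerDr scalerA divfK ?gt_eqF// addrAC -scalerDl.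
    by rewrite addrC addrCA subrr addr0 scale1r addrC.
  have [ys Ty] := CT hC.
  have ysv := Talpha h ys h_gt0 hh0 Ty.
  have [zs [Tz zn zM zE]] := extend_bounded (ltW M0) Ty (HM h ys (ltW h_gt0) hh0 Ty ysv).
  by exists zs => _ _; split=> //; rewrite zE.
have [G [UG sG]] := ultraFilterLemma (@at_right_proper_filter R 0).
have Gh : G [set h | 0 < h /\ h < h0].
  apply: sG; near=> h; split; near: h.
    exact: nbhs_right_gt.
  exact: nbhs_right_lt.
have GM : G [set h | dual_bounded M (zs h)].
  by apply: filterS Gh => h [h1 h2]; case: (zsP h h1 h2).
have [l zsl] := dual_ultra_cvg UG GM.
exists l.
  apply: (@demiclosed_filter _ _ T _ G (fun h => x + h *: v) zs x l M demT) => //.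
  - by apply: filterS Gh => h [h1 h2]; case: (zsP h h1 h2).
  - have h1 : (fun h : R => x + h *: v) @ (0 : R)^'+ --> x.
      rewrite -[X in _ --> X]addr0 -(scale0r v).
      apply: cvgD; first exact: cvg_cst.
      apply: cvgZr_tmp; exact: cvg_at_right_filter.
    by move=> A /h1; exact: sG.
  - by apply: filterS Gh => h [h1 h2]; case: (zsP h h1 h2).
have h1 : (fun h => zs h v : R) @ G --> (l v : R) by have /dual_cvgP := zsl; exact.
apply: (cvgr_to_ge h1).
by apply: filterS Gh => h [h1' h2]; case: (zsP h h1' h2).
Unshelve. all: by end_near. Qed.

(** Near an adherent xs one has ys(v) >= xs(v) - 1, so the case h = 0 of [bounded_near_end] bounds
    these ys on Y. Their extensions have a limit in T x that agrees with xs on Y, which suffices by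
    [change_off_direction]. *)
Lemma demiclosed_values_closed x : demiclosed T -> dom T x -> closed (T x).
Proof.
move=> demT Dx xs clxs; pose v := c0 - x.
have Dx' := clT Dx.
have Yv : Y v by apply: (frame_directionB frame) => //; exact: (frame_center frame).
have eC : rel_interior Y C (x + 1 *: v).
  by rewrite scale1r subrKC; case: frame => _ _ _ _ [].
have [M M0 HM] := bounded_near_end (xs v - 1) Dx' ltr01 Yv eC.
have PF := within_nbhs_proper clxs.
have [G [UG sG]] := ultraFilterLemma PF.
have /choice[E EP] : forall ys, exists zs, T x ys -> xs v - 1 <= ys v ->
    [/\ T x zs, dual_norm zs <= M, dual_bounded M zs & forall u, Y u -> zs u = ys u].
  move=> ys; have [Ty|nT] := pselect (T x ys); last by exists 0.
  have [yv|yv] := leP (xs v - 1) (ys v); last by exists 0 => _ h; lra.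
  have [|zs zsP] := extend_bounded (ltW M0) Ty; last by exists zs.
  by apply: (HM 0) => //; rewrite scale0r addr0.
have GT : G (T x) by apply: sG; exact: withinT.
have Gxs : G --> xs by move=> A xsA; apply: sG; apply: filterS xsA => ys Ays _.
have Gev u : (fun ys : dual X => ys u : R) @ G --> (xs u : R).
  by have /dual_cvgP := Gxs; exact.
have Gv : G [set ys : dual X | xs v - 1 <= ys v].
  have : xs v - 1 < xs v by lra.
  move=> /(cvgr_gt _ (Gev v)); apply: filterS => ys; exact: ltW.
have GE : G [set ys | T x ys /\ xs v - 1 <= ys v] by exact: filterI GT Gv.
have [|l El] := @dual_ultra_cvg _ _ _ G E M UG.
  by apply: filterS GE => ys [Ty yv]; case: (EP ys Ty yv).
have Tl : T x l.
  apply: (@demiclosed_filter _ _ T _ G (fun=> x) E x l M demT) => //.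
  - by apply: filterS GE => ys [Ty yv]; case: (EP ys Ty yv).
  - exact: cvg_cst.
  - by apply: filterS GE => ys [Ty yv]; case: (EP ys Ty yv).
apply: (change_off_direction Tl) => u Yu.
apply: (cvg_unique _ (Gev u)) => //.
have h1 : (fun ys => E ys u : R) @ G --> (l u : R) by have /dual_cvgP := El; exact.
apply: cvg_trans h1; apply: near_eq_cvg.
by apply: filterS GE => ys [Ty yv]; case: (EP ys Ty yv) => _ _ _ /(_ u Yu).
Qed.

Lemma condition_D_H : condition_D T -> condition_H T.
Proof.
move=> [kT demT]; split=> [x Dx|x v Dx Kv].
  by split; [exact: demiclosed_values_closed|exact: kT].
have [h0 h00 hC] := ri_tangent_cone frame Dx Kv.
have Yv : Y v by apply: (tangent_cone_direction frame Dx); case: Kv.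
set I := ereal_inf _; set S := ereal_sup _.
have I_le h ys : 0 < h -> T (x + h *: v) ys -> (I <= (ys v)%:E)%E.
  move=> h_gt0 Ty; apply: (@le_trans _ _ (ereal_inf [set (xs v)%:E | xs in T (x + h *: v)])).
    by apply: ereal_inf_lbound; exists h.
  by apply: ereal_inf_lbound; exists ys.
(* The value -oo is trivial, and +oo is excluded because T (x + h0 v) is nonempty; a real infimum
   serves as the bound in [demiclosed_end]. *)
case: I I_le => [alpha| |] I_le; last by rewrite leNye.
- have [|xs Tx xv] := demiclosed_end (alpha := alpha) demT Dx h00 Yv hC.
    by move=> h ys h_gt0 _ Ty; rewrite -lee_fin; exact: I_le Ty.
  by apply: le_ereal_sup_tmp; exists (xs v)%:E; [exists xs|].
- have [ys Ty] := CT (rel_interior_self frame hC).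
  by have := I_le h0 ys h00 Ty.
Qed.

End ConditionH.

(** * From condition (H) to maximality *)

Section Maximality.
Context {R : realType} {X : completeNormedModType R}.
Variables (T : X -> set (dual X)) (Y C : set X) (c0 : X).
Hypothesis mT : monotone_op T.
Hypothesis frame : convex_frame Y C (dom T) c0.
Hypothesis TN : T = op_add T (normal_cone (dom T)).
Implicit Types (a v : X) (ys n : dual X).

Let cT := closure (dom T).
Let K a := tangent_cone cT a.
Let clT a : dom T a -> cT a. Proof. exact: subset_closure. Qed.

Variables (x : X) (xs : dual X).
Hypothesis relx : forall a ys, T a ys -> 0 <= (xs - ys) (x - a).

(** Bipolar argument: a functional separating v from the closed convex cone K a is normal at a and
    positive at v. *)
Lemma tangent_cone_polar a v : dom T a ->
  (forall n, normal_cone (dom T) a n -> n v <= 0) -> K a v.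
Proof.
move=> Da nv; apply: contrapT => nKv.
have [n [nv0 nK]] := closed_cone_separation
  (tangent_cone_convex_cone frame (clT Da)) (@tangent_cone_closed _ _ _ _) nKv.
have : normal_cone (dom T) a n.
  split=> // y Dy; apply: nK.
  by rewrite -[y - a]scale1r; exact: tangent_cone_mem (clT Dy).
by move=> /nv; lra.
Qed.

(** T a contains the whole ray ys + t n with t >= 0, whose values at v would exceed c if n v were
    positive. *)
Lemma normal_cone_unbounded a ys v (c : R) n : T a ys -> normal_cone (dom T) a n ->
  (forall zs, T a zs -> zs v <= c) -> n v <= 0.
Proof.
move=> Ta Nn bv; rewrite leNgt; apply/negP => nv0.
pose t := (`|c - ys v| + 1) / n v.
have t0 : 0 <= t by rewrite divr_ge0 ?addr_ge0// ltW.
have := bv _ (normal_add TN Ta (normal_cone_scale t0 Nn)).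
rewrite dualDE dualZE /t divfK ?gt_eqF//.
by have := ler_norm (c - ys v); lra.
Qed.

(** Relatedness bounds T a at x - a by xs(x - a), so normal vectors are nonpositive there and
    polarity applies. *)
Lemma related_tangent a : dom T a -> K a (x - a).
Proof.
move=> Da; apply: tangent_cone_polar => // n Nn.
have [ys Ta] := Da.
apply: (@normal_cone_unbounded a ys _ (xs (x - a)) n Ta Nn) => zs Tz.
by have := relx Tz; rewrite dualBE; lra.
Qed.

Hypothesis HT : condition_H T.

(** Since x = b - s v lies behind b + h v, relatedness gives xs(v) <= ys(v) for ys in T (b + h v),
    and (H) passes this to T b. A supremum over an empty T b would be -oo, so b is in the domain. *)
Lemma condition_H_related b v (s : R) : cT b -> ri (K b) v -> 0 <= s ->
  x - b = - (s *: v) ->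
  dom T b /\ ((xs v)%:E <= ereal_sup [set (ys v)%:E | ys in T b])%E.
Proof.
move=> Db Kv s0 xb.
have xsle : ((xs v)%:E <= ereal_sup [set (ys v)%:E | ys in T b])%E.
  apply: le_trans (HT.2 b v Db Kv).
  apply: le_ereal_inf_tmp => _ [h /= h0 <-]; apply: le_ereal_inf_tmp => _ [ys Ty <-].
  rewrite lee_fin; have := relx Ty.
  have -> : x - (b + h *: v) = - ((s + h) *: v).
    by rewrite opprD addrA xb scalerDl opprD.
  rewrite linearN linearZ /= -[_ *: _]/((s + h) * (xs v - ys v)) -mulrN.
  by rewrite pmulr_rge0 ?ltr_wpDl//; lra.
split=> //; apply: contrapT => nDb.
have T0 : [set (ys v)%:E | ys in T b] = set0.
  by rewrite -subset0 => y [ys Ty _]; apply: nDb; exists ys.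
by move: xsle; rewrite T0 ereal_sup0 leeNy_eq.
Qed.

Lemma related_direction : Y (x - c0).
Proof.
have Dc0 : dom T c0.
  by case: frame => _ _ _ [CD _] [? _]; apply: CD; exact: (rel_interior_self frame).
exact: (tangent_cone_direction frame (clT Dc0) (related_tangent Dc0)).
Qed.

Lemma rel_interior_ri_center a : cT a -> rel_interior Y (K a) (c0 - a) /\ ri (K a) (c0 - a).
Proof.
move=> Da; have h := rel_interior_center frame a.
by split=> //; exact: (rel_interior_ri frame Da h).
Qed.

(* Otherwise the last point b of cl (dom T) on the segment from c0 to x would, by (H),
   be in dom T, so x - b and its opposite direction c0 - b would both be
   tangent at b, which puts b in the relative interior of C. *)
Lemma related_closure : cT x.
Proof.
apply: contrapT => nTx.
have Yx := related_direction.
have c0C : rel_interior Y C c0 by case: frame => _ _ _ _ [].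
have CT : C `<=` dom T by case: frame => _ _ _ [].
pose seg (s : R) := c0 + s *: (x - c0).
pose L := 1 + `|x - c0|.
have L0 : 0 < L by rewrite ltr_pwDl.
have YZ (s : R) u : Y u -> Y (s *: u).
  case: frame => _ [Y0 YS] _ _ _ Yu.
  by rewrite -[_ *: _]addr0; exact: YS.
have dist_seg s t : `|seg s - seg t| <= `|s - t| * L.
  rewrite /seg opprD addrACA subrr add0r -scalerBl normrZ ler_wpM2l//.
  by rewrite lerDr.
pose A := [set s : R | [/\ 0 <= s, s <= 1 & cT (seg s)]].
have A0 : A 0 by split=> //; rewrite /seg scale0r addr0; exact: (frame_center frame).
have ubA : has_ubound A by exists 1 => s [].
have supA : has_sup A by split => //; exists 0.
pose s := sup A.
have s_le1 : s <= 1 by apply: ge_sup; [exists 0|move=> t []].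
have Ds : cT (seg s).
  apply: (@closed_closure _ (dom T)); apply/closure_normP => e e0.
  have [t At st] := sup_adherent (divr_gt0 e0 L0) supA.
  have ts : t <= s by exact: ub_le_sup.
  exists (seg t); first by case: At.
  apply: le_lt_trans (dist_seg t s) _; rewrite -ltr_pdivlMr//.
  by rewrite -/s in st; rewrite distrC ger0_norm ?subr_ge0//; lra.
(* Used twice: t = 0 gives s > 0, and t = s contradicts the choice of s as a supremum. *)
have advance t : 0 <= t -> t < 1 -> rel_interior Y C (seg t) -> exists2 t', t < t' & A t'.
  move=> t0 t1 [r r0 rC]; pose d := Num.min (1 - t) (r / (2 * L)).
  have d0 : 0 < d by rewrite lt_min subr_gt0 t1 divr_gt0// mulr_gt0.
  have d1 : d <= 1 - t by rewrite ge_min lexx.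
  exists (t + d); first by rewrite ltrDl.
  split; [lra|lra|apply/clT/CT].
  rewrite /seg scalerDl addrA; apply: rC; first exact: YZ.
  rewrite normrZ gtr0_norm//; apply: (@le_lt_trans _ _ (r / (2 * L) * L)).
    by apply: ler_pM; rewrite ?(ltW d0)// ?ge_min ?lexx ?orbT// lerDr.
  have -> : r / (2 * L) * L = r / 2 by field; rewrite gt_eqF.
  by lra.
have s_lt1 : s < 1.
  rewrite lt_neqAle s_le1 andbT; apply/eqP => s1; apply: nTx.
  by move: Ds; rewrite /seg s1 scale1r subrKC.
have s0 : 0 < s.
  have [|t t0 At] := advance 0 (lexx _) ltr01; first by rewrite /seg scale0r addr0.
  by apply: lt_le_trans t0 _; exact: ub_le_sup.
set b := seg s in Ds.
have [bK briK] := rel_interior_ri_center Ds.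
have vE : c0 - b = - (s *: (x - c0)) by rewrite /b /seg opprD addNKr.
have xbE : x - b = (1 - s) *: (x - c0).
  by rewrite scalerBl scale1r -vE addrA subrK.
pose k := (1 - s) / s.
have k0 : 0 < k by rewrite divr_gt0 ?subr_gt0.
have xb : x - b = - (k *: (c0 - b)).
  by rewrite vE scalerN opprK scalerA divfK ?gt_eqF.
have [Db _] := condition_H_related Ds briK (ltW k0) xb.
have k10 : 0 < 1 + k by rewrite addr_gt0.
(* The weight k / (1 + k) makes the combination of c0 - b and x - b = - k (c0 - b) vanish, so 0 is
   relatively interior to the tangent cone; [ri_tangent_cone] in the direction 0 then concerns b
   itself. *)
have := rel_interior_cone_segment frame Ds (related_tangent Db) bK (divr_gt0 k0 k10).
rewrite ler_pdivrMr// mul1r => /(_ ltac:(lra)).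
have -> : k / (1 + k) *: (c0 - b) + (1 - k / (1 + k)) *: (x - b) = 0.
  rewrite xb scalerN scalerA -scalerBl.
  have -> : k / (1 + k) - (1 - k / (1 + k)) * k = 0 by field; rewrite gt_eqF.
  by rewrite scale0r.
move=> /(rel_interior_ri frame Ds)/(ri_tangent_cone frame Ds)[h h0].
rewrite scaler0 addr0 => /(advance s (ltW s0) s_lt1)[t st At].
by have := ub_le_sup ubA At; rewrite leNgt st.
Qed.

(** With s = 0, (H) bounds xs(v) by the supremum over T x for v in the relative interior of the
    tangent cone. A separating v0 is only known to be tangent, so it is tilted towards v1 = c0 - x,
    where an element p of T c0 bounds T x. *)
Lemma related_mem : T x xs.
Proof.
have Dx := related_closure.
have [v1C v1ri] := rel_interior_ri_center Dx.
set v1 := c0 - x in v1C v1ri.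
have use_H v : ri (K x) v ->
    dom T x /\ ((xs v)%:E <= ereal_sup [set (ys v)%:E | ys in T x])%E.
  move=> Kv; apply: (condition_H_related Dx Kv (lexx 0)).
  by rewrite subrr scale0r oppr0.
have [DTx _] := use_H v1 v1ri.
have [ys0 Ty0] := DTx.
apply: contrapT => nTx.
have [clTx kTx] := HT.1 x DTx.
have [v0 [e [e0 v0e]]] := dual_separation clTx kTx nTx.
have Kv0 : K x v0.
  apply: tangent_cone_polar => // n Nn.
  exact: (normal_cone_unbounded Ty0 Nn v0e).
have [p Tp] : dom T c0.
  by case: frame => _ _ _ [CD _] [? _]; apply: CD; exact: (rel_interior_self frame).
have v1p ys : T x ys -> ys v1 <= p v1.
  by move=> Ty; have := mT Tp Ty; rewrite dualBE -/v1; lra.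
have key (t : R) : 0 < t -> t <= 1 -> t * xs v1 <= t * p v1 - (1 - t) * e.
  move=> t0 t1; have Kt := rel_interior_cone_segment frame Dx Kv0 v1C t0 t1.
  have ev ys : ys (t *: v1 + (1 - t) *: v0) = t * ys v1 + (1 - t) * ys v0 :> R.
    by rewrite linearD !linearZ.
  have [_ xs_le] := use_H _ (rel_interior_ri frame Dx Kt).
  have /(le_trans xs_le) : (ereal_sup [set (ys (t *: v1 + (1 - t) *: v0))%:E | ys in T x]
      <= (t * p v1 + (1 - t) * (xs v0 - e))%:E)%E.
    apply: ge_ereal_sup => _ [ys Ty <-]; rewrite lee_fin ev.
    apply: lerD; first by rewrite ler_pM2l// v1p.
    by rewrite ler_wpM2l ?subr_ge0// v0e.
  by rewrite lee_fin ev; lra.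
pose B := `|p v1 - xs v1|.
have B0 : 0 <= B by exact: normr_ge0.
have D0 : 0 < 2 * (e + B) by rewrite mulr_gt0// ltr_pwDl.
(* For this t one has t B = e / 2 - t e, which is less than (1 - t) e and contradicts [key]. *)
pose t := e / (2 * (e + B)).
have t0 : 0 < t by rewrite divr_gt0.
have tE : t * (2 * (e + B)) = e by rewrite divfK// gt_eqF.
have t1 : t <= 2^-1.
  by rewrite ler_pdivrMr//; lra.
have := key t t0 ltac:(lra).
have : t * (p v1 - xs v1) <= t * B by rewrite ler_pM2l// ler_norm.
have : t * e <= 2^-1 * e by rewrite ler_pM2r.
have : 0 < t * e by rewrite mulr_gt0.
lra.
Qed.

End Maximality.

(** * Assembly of the implications from (R) to (D) to (H) to maximality, and back to all three *)

Theorem theorem25 (R : realType) (X : completeNormedModType R)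
    (T : X -> set (dual X))
    (dimX : dim_gt1 X)
    (T_nonempty : graph T !=set0)
    (T_monotone : monotone_op T)
    (domT_nearly_convex : nearly_convex (dom T))
    (domT_not_singleton : ~ exists x : X, dom T = [set x]) :
  (maximal_monotone T <->
     T = op_add T (normal_cone (dom T)) /\
     (condition_H T \/ condition_D T \/ condition_R T)) /\
  (maximal_monotone T <->
     T = op_add T (normal_cone (dom T)) /\
     (condition_H T /\ condition_D T /\ condition_R T)).
Proof.
have [Y [C [c0 frame]]] := nearly_convex_frame domT_nearly_convex.
have D_H TN := condition_D_H T_monotone frame TN.
have H_max : T = op_add T (normal_cone (dom T)) -> condition_H T -> maximal_monotone T.
  move=> TN HT; apply/maximal_monotoneP; split=> // x xs relx.
  exact: (related_mem T_monotone frame TN relx HT).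
have max_all : maximal_monotone T -> T = op_add T (normal_cone (dom T)) /\
    (condition_H T /\ condition_D T /\ condition_R T).
  move=> maxT; have TN := op_add_normal_cone maxT.
  have DT := maximal_monotone_D maxT.
  by split=> //; split; [exact: D_H|split=> //; exact: maximal_monotone_R].
split; split.
- by move=> /max_all[TN [HT _]]; split=> //; left.
- move=> [TN [HT|[DT|RT]]]; apply: H_max => //; apply: D_H => //.
  exact: representable_D.
- exact: max_all.
- by move=> [TN [HT _]]; exact: H_max.
Qed.
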